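(* Let $P,Q\in W^{(l)}$ and $(\rho,\sigma)\in\mathfrak V$ with $\sigma\le0$. Suppose $[Q,P]=1$, $v_{\rho,\sigma}(P)>0$, $v_{\rho,\sigma}(Q)>0$, $[P,Q]_{\rho,\sigma}=0$, $v_{\rho,\sigma}(P)/v_{\rho,\sigma}(Q)\notin\mathbb{N}$ and $v_{\rho,\sigma}(Q)/v_{\rho,\sigma}(P)\notin\mathbb{N}$. Then: (1) If $(\rho,\sigma)\notin\mathrm{Val}(P)$, then $v_{1,-1}(\ell_{\rho,\sigma}(P))\ne0$. (2) $v_{1,-1}(\mathrm{st}_{\rho,\sigma}(P))\neq0$. (3) There exists a $(\rho,\sigma)$-homogeneous $F\in W^{(l)}$ with $[P,F]_{\rho,\sigma}=\ell_{\rho,\sigma}(P)$ and $[Q,F]_{\rho,\sigma}=\frac{v_{\rho,\sigma}(Q)}{v_{\rho,\sigma}(P)}\ell_{\rho,\sigma}(Q)$; moreover $v_{\rho,\sigma}(F)=\rho+\sigma$ and $f^{(l)}_{[P,F],\rho,\sigma}=f^{(l)}_{P,\rho,\sigma}$.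
   Context: $K$ is a field of characteristic zero, $l\in\mathbb{N}$. $W^{(l)}$ is the associative $K$-algebra with $K$-basis $\{X^{i/l}Y^j:i\in\mathbb{Z},j\in\mathbb{N}_0\}$, powers of $X$ multiplying as Laurent monomials and $[Y,X^{\alpha}]=\alpha X^{\alpha-1}$ for $\alpha\in\frac1l\mathbb{Z}$. $L^{(l)}=K[x^{1/l},x^{-1/l},y]$, $\Psi^{(l)}(X^{i/l}Y^j)=x^{i/l}y^j$ ($K$-linear); $\mathrm{Supp}$ = exponents with nonzero coefficient (for $P\in W^{(l)}$, of $\Psi^{(l)}(P)$). $\mathfrak V=\{(\rho,\sigma)\in\mathbb{Z}^2:\gcd(\rho,\sigma)=1,\rho+\sigma>0\}$; $v_{\rho,\sigma}(a,b)=\rho a+\sigma b$. For $P\ne0$: $v_{\rho,\sigma}(P)=\max$ of $v_{\rho,\sigma}$ over $\mathrm{Supp}(P)$ (this also defines $v_{1,-1}$ of a nonzero element of $L^{(l)}$); $\ell_{\rho,\sigma}(P)$ is the sum of the terms of $\Psi^{(l)}(P)$ of $(\rho,\sigma)$-degree $v_{\rho,\sigma}(P)$; $(\rho,\sigma)$-homogeneous means equal to its leading term (or $0$). $\mathrm{st}_{\rho,\sigma}(P)$ is, among the points $(a,b)\in\mathrm{Supp}(\ell_{\rho,\sigma}(P))$ maximizing $a-b$, the one with largest $a$. $\mathrm{Val}(P)=\{(\rho,\sigma)\in\mathfrak V:\#\mathrm{Supp}(\ell_{\rho,\sigma}(P))>1\}$. $[P,Q]_{\rho,\sigma}:=0$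 if $[P,Q]=0$ or $v_{\rho,\sigma}([P,Q])<v_{\rho,\sigma}(P)+v_{\rho,\sigma}(Q)-(\rho+\sigma)$, and $:=\ell_{\rho,\sigma}([P,Q])$ otherwise. For $\sigma\le0$ and $P\ne0$, write $\ell_{\rho,\sigma}(P)=\sum_{i=0}^\gamma a_ix^{\frac rl-\frac{i\sigma}\rho}y^{s+i}$ with $a_0\ne0\ne a_\gamma$ and set $f^{(l)}_{P,\rho,\sigma}=\sum_{i=0}^\gamma a_ix^i$. *)

(* Defs.v *)
(* W^(l) is modelled as the K-vector space of finitely
   supported functions (int * nat) -> K (multinomials' monalg), where the
   key (i, j) stands for the basis element X^(i/l) Y^j.  The Weyl product
   is defined explicitly below. *)
From HB Require Import structures.
From mathcomp Require Import all_boot all_order all_algebra.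
From mathcomp Require Import finmap.
From mathcomp.multinomials Require Import monalg.

Set Implicit Arguments.
Unset Strict Implicit.
Unset Printing Implicit Defensive.

Import Order.TTheory GRing.Theory Num.Theory.
Local Open Scope ring_scope.

(* exponent keys: (i, j) represents x^(i/l) y^j *)
Definition expo := (int * nat)%type.

(* the underlying vector space of W^(l) (and, via Psi^(l), of L^(l)) *)
Definition W (K : fieldType) := {malg K[expo]}.

Section Weyl.
Context (K : fieldType) (l : nat).

Definition ffact (i : int) (k : nat) : K :=
  \prod_(t < k) ((i%:~R / l%:R) - t%:R).

(* product of basis elements:
   (X^a Y^j)(X^b Y^n) = sum_{k<=j} C(j,k) (b)_k X^(a+b-k) Y^(j+n-k),
   which is forced by [Y, X^b] = b X^(b-1). *)
Definition wmul (P Q : W K) : W K :=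
  \sum_(u <- msupp P) \sum_(w <- msupp Q) \sum_(k < u.2.+1)
     << (P@_u * Q@_w * 'C(u.2, k)%:R * ffact w.1 k)
        *g ((u.1 + w.1 - (k * l)%N%:Z)%R, (u.2 + w.2 - k)%N) >>.

Definition wone : W K := << (1 : K) *g ((0%R : int), 0%N) >>.

Definition wbr (P Q : W K) : W K := wmul P Q - wmul Q P.

Section Valuation.
Context (rho sigma : int).

Definition vpt (u : expo) : rat :=
  rho%:~R * (u.1%:~R / l%:R) + sigma%:~R * u.2%:R.

(* v_{rho,sigma}(P) = max over Supp(P); (value 0 for P = 0, never used) *)
Definition vv (P : W K) : rat :=
  \big[Num.max/vpt (head (0%R, 0%N) (msupp P))]_(u <- msupp P) vpt u.

(* leading form l_{rho,sigma}(P) (an element of L^(l), stored via Psi^(l)) *)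
Definition lt (P : W K) : W K :=
  \sum_(u <- msupp P | vpt u == vv P) << P@_u *g u >>.

Definition homogeneous (P : W K) : Prop := lt P = P.

Definition inVal (P : W K) : Prop := (1 < #|` msupp (lt P)|)%N.

Definition wbr_rs (P Q : W K) : W K :=
  let C := wbr P Q in
  if (C == 0) || (vv C < vv P + vv Q - (rho + sigma)%:~R) then 0 else lt C.

(* f^(l)_{P,rho,sigma} : a_i = coefficient of the (unique) point of
   Supp(l(P)) whose y-exponent is s + i, s = least y-exponent. *)
Definition fpol (P : W K) : {poly K} :=
  let L := lt P in
  let N := (\max_(u <- msupp L) u.2).+1 in
  let s := \big[minn/N]_(u <- msupp L) u.2 in
  \poly_(i < N) (\sum_(u <- msupp L | u.2 == (s + i)%N) L@_u).

End Valuation.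

Definition argmax_seq (T : Type) (f : T -> rat) (x0 : T) (s : seq T) : T :=
  foldl (fun m x => if f m < f x then x else m) (head x0 s) s.

Definition st (rho sigma : int) (P : W K) : expo :=
  let S := msupp (lt rho sigma P) : seq expo in
  let m := vv 1 (-1) (lt rho sigma P) in
  argmax_seq (fun u : expo => u.1%:~R) (0%R, 0%N)
    [seq u <- S | vpt 1 (-1) u == m].

End Weyl.

(* Main.v *)
Require Import Defs.
From Stdlib Require Classical_Prop.
From HB Require Import structures.
From mathcomp Require Import all_boot all_order all_algebra.
From mathcomp Require Import finmap zify ring.
From mathcomp.multinomials Require Import monalg.
Import Order.TTheory GRing.Theory Num.Theory.
Local Open Scope ring_scope.

Set Implicit Arguments.
Unset Strict Implicit.
Unset Printing Implicit Defensive.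

(** Write [h = rho + sigma], let [p] be the leading form of [P], of degree
    [a > 0], and let [{ , }] be the Poisson bracket that [[ , ]] induces on
    leading forms; it has degree [- h].

    Some [R] in the subalgebra generated by [P] and [Q] satisfies
    [{p, r} <> 0], where [r] is the leading form of [R].  Indeed, if the leading
    forms of all combinations of the [P^i Q^j] with [i < I], [j < J] commuted
    with [p], they would be pairwise proportional in each degree, so these
    [I J] independent elements would have a combination of degree at most about
    [I a + J v(Q) - I J / l].  But [ad P] lowers the degree in [Q] by one and raises
    [v] by at most [a], and it leads any such combination to a nonzero
    polynomial in [P], of degree at least [0]; so no combination has degree
    below [- J a].  Applying [ad P] further, one may also assume that
    [s := {p, r}] commutes with [p].

    Then [f := p r / s] solves [{p, f} = p].  Setting [x = 1], homogeneous
    elements become polynomials in [y], the bracket of elements of degrees [d]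
    and [e] becomes [(e p' r - d p r') / rho], and comparing the multiplicities
    of an irreducible polynomial shows that [s] divides [p r].  The same equation
    at the lowest order in [y] excludes [v_{1,-1}(p) = 0]. *)

(** * The algebra [W^(l)] *)

Section LinearExtension.
Context (K : fieldType) (V : lmodType K).
Implicit Types (P Q : W K) (u : expo) (g : expo -> V).

Definition lext g P : V := \sum_(u <- msupp P) P@_u *: g u.

Lemma lextEw g P (d : {fset expo}) : (msupp P `<=` d)%fset ->
  lext g P = \sum_(u <- d) P@_u *: g u.
Proof.
move=> sPd; rewrite /lext (big_fset_incl _ sPd) // => u _ /mcoeff_outdom ->.
by rewrite scale0r.
Qed.

Lemma lext_is_linear g : linear (lext g).
Proof.
move=> c P Q; set d := (msupp P `|` msupp Q)%fset.
rewrite (@lextEw _ (c *: P + Q) d) ?(@lextEw _ P d) ?(@lextEw _ Q d);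
  rewrite ?fsubsetUl ?fsubsetUr //.
- rewrite scaler_sumr -big_split; apply: eq_bigr => u _ /=.
  by rewrite mcoeffD mcoeffZ scalerDl scalerA.
- apply/fsubsetP => u; rewrite -mcoeff_neq0 mcoeffD mcoeffZ in_fsetU.
  rewrite -!mcoeff_neq0; apply: contraNT; rewrite negb_or !negbK.
  by move=> /andP[/eqP-> /eqP->]; rewrite mulr0 addr0.
Qed.

HB.instance Definition _ g :=
  GRing.isLinear.Build K (W K) V *:%R (lext g) (lext_is_linear g).

Lemma malgUZ (c : K) u : << c *g u >> = c *: << 1 *g u >> :> W K.
Proof. by apply/malgP => w; rewrite mcoeffZ [LHS]mcoeffU [in RHS]mcoeffU mulr_natr. Qed.

Lemma lextU g u : lext g << 1 *g u >> = g u.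
Proof.
by rewrite /lext msuppU oner_eq0 big_seq_fset1 mcoeffUU scale1r.
Qed.

Lemma linear_lext (f : {linear W K -> V}) P : f P = lext (fun u => f << u >>) P.
Proof.
rewrite {1}[P]monalgE linear_sum; apply: eq_bigr => u _.
by rewrite malgUZ linearZ.
Qed.

Lemma eq_linear_malg (f g : {linear W K -> V}) :
  (forall u, f << u >> = g << u >>) -> f =1 g.
Proof.
by move=> fg P; rewrite (linear_lext f) (linear_lext g); apply: eq_bigr => u _; rewrite fg.
Qed.

End LinearExtension.

(** * Associativity of the explicit product, and the commutator as a derivation *)

Section WeylAlgebra.
Context (K : fieldType) (charK : [pchar K] =i pred0).
Context (l : nat) (l_gt0 : (0 < l)%N).
Implicit Types (P Q R : W K) (u w : expo).

Lemma natr_neq0 n : (n.+1%:R : K) != 0.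
Proof. by move/pcharf0P: charK => ->. Qed.

Lemma lR_neq0 : (l%:R : K) != 0.
Proof. by case: l l_gt0 => // n _; apply: natr_neq0. Qed.

(* [lX a] and [lY] are the left multiplications by [X^(a/l)] and by [Y]: the
   latter is [y + d/dx] on [L^(l)]. *)
Definition lX (a : int) : W K -> W K := lext (fun u => << (u.1 + a, u.2) >>).
Definition lY : W K -> W K :=
  lext (fun u => << (u.1, u.2.+1) >> +
                 (u.1%:~R / l%:R) *: << (u.1 - l%:Z, u.2) >>).
Definition lmon u R : W K := lX u.1 (iter u.2 lY R).

HB.instance Definition _ a := GRing.Linear.copy (lX a) (lX a).
HB.instance Definition _ := GRing.Linear.copy lY lY.

Lemma lYiter_is_linear n : linear (iter n lY).
Proof. by move=> c P Q; elim: n => //= n ->; rewrite linearP. Qed.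

Lemma lmon_is_linear u : linear (lmon u).
Proof. by move=> c P Q; rewrite /lmon lYiter_is_linear linearP. Qed.

HB.instance Definition _ u :=
  GRing.isLinear.Build K (W K) (W K) *:%R (lmon u) (lmon_is_linear u).

Definition bas u w : W K := \sum_(k < u.2.+1)
   << 'C(u.2, k)%:R * ffact K l w.1 k
      *g (u.1 + w.1 - (k * l)%N%:Z, (u.2 + w.2 - k)%N) >>.

Lemma ffactS i k :
  ffact K l i k.+1 = ffact K l i k * ((i - (k * l)%N%:Z)%:~R / l%:R).
Proof.
rewrite /ffact big_ord_recr /=; congr (_ * _).
by rewrite intrB -!pmulrn natrM mulrBl mulfK ?lR_neq0.
Qed.

(** Induction with Pascal's rule: of the two terms of [lY], the first keeps [k] and the second,
    d/dx, raises it by one. *)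
Lemma lYiterU j w : iter j lY << w >> =
  \sum_(k < j.+1) << 'C(j, k)%:R * ffact K l w.1 k
      *g (w.1 - (k * l)%N%:Z, (j + w.2 - k)%N) >>.
Proof.
elim: j => [|j IH].
  rewrite big_ord1 bin0 mul1r /ffact big_ord0 mul0n subr0 add0n subn0.
  by case: w.
rewrite iterS IH linear_sum /=.
under eq_bigr => k _.
  rewrite malgUZ linearZ /= /lY lextU /= scalerDr scalerA -mulrA -ffactS.
  rewrite -!malgUZ.
  have -> : ((j + w.2 - k).+1 = j.+1 + w.2 - k)%N by have := ltn_ord k; lia.
  have -> : w.1 - (k * l)%N%:Z - l%:Z = w.1 - (k.+1 * l)%N%:Z by lia.
  have -> : (j + w.2 - k = j.+1 + w.2 - k.+1)%N by lia.
  over.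
rewrite big_split /= big_ord_recl [in RHS]big_ord_recl !bin0 -addrA.
congr (_ + _).
under [in RHS]eq_bigr => k _ do rewrite lift0 binS natrD mulrDl raddfD /=.
rewrite big_split /=; congr (_ + _).
rewrite [in RHS]big_ord_recr /= bin_small // mul0r raddf0 addr0.
by apply: eq_bigr.
Qed.

Lemma lmonU u w : lmon u << w >> = bas u w.
Proof.
rewrite /lmon lYiterU linear_sum; apply: eq_bigr => k _ /=.
rewrite malgUZ linearZ /= /lX lextU -malgUZ /=.
have -> : w.1 - (k * l)%N%:Z + u.1 = u.1 + w.1 - (k * l)%N%:Z by lia.
by [].
Qed.

(** Turns the triple sum into operators acting on [R]; bilinearity and associativity are read off
    from this form. *)
Lemma wmul_lmon P R : wmul l P R = lext (fun u => lmon u R) P.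
Proof.
apply: eq_bigr => u _; rewrite (linear_lext (lmon u)) /lext scaler_sumr.
apply: eq_bigr => w _.
rewrite -[RHS]/(P@_u *: (R@_w *: lmon u << w >>)) lmonU scalerA scaler_sumr.
by apply: eq_bigr => k _; rewrite [in RHS]malgUZ [in LHS]malgUZ scalerA !mulrA.
Qed.

Lemma wmulUl u R : wmul l << u >> R = lmon u R.
Proof. by rewrite wmul_lmon lextU. Qed.

Lemma wmulU u w : wmul l << u >> << w >> = bas u w.
Proof. by rewrite wmulUl lmonU. Qed.

Lemma wmul_is_linear P : linear (wmul l P).
Proof.
move=> c Q R; rewrite !wmul_lmon /lext scaler_sumr -big_split.
apply: eq_bigr => u _ /=.
by rewrite lmon_is_linear scalerDr !scalerA mulrC.
Qed.
HB.instance Definition _ P :=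
  GRing.isLinear.Build K (W K) (W K) *:%R (wmul l P) (wmul_is_linear P).

Definition wmulr Q P := wmul l P Q.
Lemma wmulr_is_linear Q : linear (wmulr Q).
Proof. by move=> c P R; rewrite /wmulr !wmul_lmon linearP. Qed.
HB.instance Definition _ Q :=
  GRing.isLinear.Build K (W K) (W K) *:%R (wmulr Q) (wmulr_is_linear Q).

Local Opaque wmul.

Lemma lX0 P : lX 0 P = P.
Proof.
apply: (@eq_linear_malg _ _ (lX 0) idfun) => u.
by rewrite /= /lX lextU addr0; case: u.
Qed.

Lemma lXD a b P : lX a (lX b P) = lX (a + b) P.
Proof.
apply: (@eq_linear_malg _ _ (lX a \o lX b) (lX (a + b))) => u.
by rewrite /= /lX (lextU _ u) (lextU _ (_, _)) (lextU _ u) /= addrAC addrA.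
Qed.

Lemma lYX b P : lY (lX b P) = lX b (lY P) + (b%:~R / l%:R) *: lX (b - l%:Z) P.
Proof.
apply: (@eq_linear_malg _ _ (lY \o lX b)
  ((lX b \o lY) \+ ((b%:~R / l%:R) \*: lX (b - l%:Z)))) => u.
rewrite /= /lX /lY.
rewrite (lextU _ u) !(lextU _ (_, _)) /=.
rewrite (lextU _ u) /=.
rewrite linearD linearZ /=.
rewrite !(lextU _ (_, _)) (lextU _ u) /=.
have -> : u.1 - l%:Z + b = u.1 + b - l%:Z by rewrite addrAC.
by rewrite [u.1 + (b - _)]addrA -[RHS]addrA -scalerDl -mulrDl -intrD.
Qed.

Lemma lX_wmul a P R : lX a (wmul l P R) = wmul l (lX a P) R.
Proof.
apply: (@eq_linear_malg _ _ (lX a \o wmulr R) (wmulr R \o lX a)) => u.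
rewrite /= /wmulr !wmul_lmon {2}/lX !lextU /lmon lXD.
by rewrite [a + _]addrC.
Qed.

Lemma lY_wmul P R : lY (wmul l P R) = wmul l (lY P) R.
Proof.
apply: (@eq_linear_malg _ _ (lY \o wmulr R) (wmulr R \o lY)) => u.
rewrite /= /wmulr !wmul_lmon {2}/lY !lextU linearD linearZ /= !lextU /lmon /=.
by rewrite lYX.
Qed.

(** Left multiplications by powers of X and by Y commute with right multiplications ([lX_wmul],
    [lY_wmul]), hence so does left multiplication by any monomial. *)
Lemma wmulA P Q R : wmul l P (wmul l Q R) = wmul l (wmul l P Q) R.
Proof.
apply: (@eq_linear_malg _ _ (wmulr (wmul l Q R)) (wmulr R \o wmulr Q)) => u.
rewrite [LHS]wmulUl [RHS]/(wmulr R (wmul l << u >> Q)) wmulUl /lmon.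
rewrite /wmulr -lX_wmul; congr (lX _ _).
elim: u.2 => [//|n IHn]; rewrite !iterS IHn; exact: lY_wmul.
Qed.

Lemma wmul1l P : wmul l (wone K) P = P.
Proof. by rewrite wmul_lmon /wone lextU /lmon /= lX0. Qed.

Lemma wmul1r P : wmul l P (wone K) = P.
Proof.
apply: (@eq_linear_malg _ _ (wmulr (wone K)) idfun) => u.
rewrite /= /wmulr /wone wmulU /bas big_ord_recl big1 => [|k _].
  rewrite /= bin0 /ffact big_ord0 mul1r mul0n subr0 addr0 addn0 subn0 addr0.
  by case: u.
have -> : ffact K l (0, 0%N).1 (lift ord0 k) = 0.
  by rewrite lift0 /ffact big_ord_recl mulr0z mul0r subrr mul0r.
rewrite mulr0; exact: raddf0.
Qed.

Lemma wbr_is_linear P : linear (wbr l P).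
Proof. by move=> c Q R; apply: (linearP (wmul l P \- wmulr P)). Qed.
HB.instance Definition _ P :=
  GRing.isLinear.Build K (W K) (W K) *:%R (wbr l P) (wbr_is_linear P).

Definition wbr_lin P : {linear W K -> W K} := wbr l P.

Definition wbrr Q P := wbr l P Q.
Lemma wbrr_is_linear Q : linear (wbrr Q).
Proof. by move=> c P R; apply: (linearP (wmulr Q \- wmul l Q)). Qed.
HB.instance Definition _ Q :=
  GRing.isLinear.Build K (W K) (W K) *:%R (wbrr Q) (wbrr_is_linear Q).

Lemma wbr1 P : wbr l P (wone K) = 0.
Proof. by rewrite /wbr wmul1l wmul1r subrr. Qed.

Lemma wbrN P Q : wbr l P Q = - wbr l Q P.
Proof. by rewrite /wbr opprB. Qed.

Lemma wmul0l P : wmul l 0 P = 0.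
Proof. exact: (linear0 (wmulr P)). Qed.

Lemma wmul0r P : wmul l P 0 = 0.
Proof. exact: (linear0 (wmul l P)). Qed.

Lemma wmulPr c P Q R : wmul l P (c *: Q + R) = c *: wmul l P Q + wmul l P R.
Proof. exact: (linearP (wmul l P)). Qed.

Lemma wmulZr c P Q : wmul l P (c *: Q) = c *: wmul l P Q.
Proof. exact: (linearZZ (wmul l P)). Qed.

Lemma wmulPl c P Q R : wmul l (c *: P + Q) R = c *: wmul l P R + wmul l Q R.
Proof. exact: (linearP (wmulr R)). Qed.

Lemma wbr0l P : wbr l 0 P = 0.
Proof. exact: (linear0 (wbrr P)). Qed.

Lemma wbr0r P : wbr l P 0 = 0.
Proof. exact: (linear0 (wbr l P)). Qed.

Lemma wbrPr c P Q R : wbr l P (c *: Q + R) = c *: wbr l P Q + wbr l P R.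
Proof. exact: (linearP (wbr l P)). Qed.

Lemma wbrPl c P Q R : wbr l (c *: P + Q) R = c *: wbr l P R + wbr l Q R.
Proof. exact: (linearP (wbrr R)). Qed.

Lemma wmulBl P Q R : wmul l (P - Q) R = wmul l P R - wmul l Q R.
Proof. exact: (linearB (wmulr R)). Qed.

Lemma wmulBr P Q R : wmul l P (Q - R) = wmul l P Q - wmul l P R.
Proof. exact: (linearB (wmul l P)). Qed.

Lemma wbrM P Q R : wbr l P (wmul l Q R) =
  wmul l (wbr l P Q) R + wmul l Q (wbr l P R).
Proof.
rewrite /wbr wmulBl wmulBr [X in X - _ = _]wmulA.
rewrite [X in _ = _ + (X - _)]wmulA [X in _ = _ + (_ - X)]wmulA.
by rewrite addrA subrK.
Qed.

Lemma wbrMl P R : wbr l P (wmul l P R) = wmul l P (wbr l P R).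
Proof.
have E : wbr l P P = 0 by rewrite /wbr subrr.
by rewrite wbrM E wmul0l add0r.
Qed.

End WeylAlgebra.

Local Opaque wmul.

(** * Leading forms as polynomials in [y] *)

Section PoissonPoly.
Context (K : fieldType).
(* [rho l] times the Poisson bracket of homogeneous elements of degrees [d] and
   [e], evaluated at [x = 1]. *)
Definition pbr (d e : int) (p q : {poly K}) : {poly K} :=
  e%:~R * p^`() * q - d%:~R * p * q^`().

Lemma mul_poly_linear (c : K) (r p q : {poly K}) :
  r * (c *: p + q) = c%:P * (r * p) + r * q.
Proof. by rewrite -mul_polyC; ring. Qed.

Lemma pbrDl d e (c : K) p1 p2 q :
  pbr d e (c *: p1 + p2) q = c%:P * pbr d e p1 q + pbr d e p2 q.
Proof. by rewrite /pbr -mul_polyC derivD derivM derivC mul0r add0r; ring. Qed.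

Lemma pbrDr d e (c : K) p q1 q2 :
  pbr d e p (c *: q1 + q2) = c%:P * pbr d e p q1 + pbr d e p q2.
Proof. by rewrite /pbr -mul_polyC derivD derivM derivC mul0r add0r; ring. Qed.

Lemma pbr0l d e q : pbr d e 0 q = 0.
Proof. by rewrite /pbr deriv0 !(mulr0, mul0r) subrr. Qed.

Lemma pbr0r d e p : pbr d e p 0 = 0.
Proof. by rewrite /pbr deriv0 !mulr0 subrr. Qed.
End PoissonPoly.

(** * The filtration by degree and its graded components *)

Section Grading.
Context (K : fieldType) (charK : [pchar K] =i pred0).
Context (l : nat) (l_gt0 : (0 < l)%N) (rho sigma : int).
Context (rho_gt0 : 0 < rho) (rs_gt0 : 0 < rho + sigma).
Implicit Types (P Q R : W K) (u w : expo) (d e : int).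

(* [deg] and [hdeg] are [l] times the valuation and [l (rho + sigma)]. *)
Definition deg u : int := rho * u.1 + sigma * (l * u.2)%N%:Z.
Definition hdeg : int := l%:Z * (rho + sigma).
(** The bound need not be attained, so that [fil d] is a subspace. *)
Definition fil d P := forall u, u \in msupp P -> deg u <= d.
(* The component of degree [d] at [x = 1]; no information is lost, since
   [rho <> 0] and [d] determine the exponent of [x] from that of [y]. *)
Definition pol d : W K -> {poly K} :=
  lext (fun u => if deg u == d then 'X^(u.2) else 0).
HB.instance Definition _ d := GRing.Linear.copy (pol d) (pol d).

Lemma pol0 d : pol d 0 = 0.
Proof. exact: linear0. Qed.

Lemma polP d c P Q : pol d (c *: P + Q) = c *: pol d P + pol d Q.
Proof. exact: linearP. Qed.

Lemma hdeg_gt0 : 0 < hdeg.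
Proof. by rewrite /hdeg; nia. Qed.

Lemma deg_inj i1 i2 j : deg (i1, j) = deg (i2, j) -> i1 = i2.
Proof. by rewrite /deg => /addIr /(mulfI (lt0r_neq0 rho_gt0)). Qed.

Lemma filP d P (c : K) Q : fil d P -> fil d Q -> fil d (c *: P + Q).
Proof.
move=> fP fQ u; rewrite -mcoeff_neq0 mcoeffD mcoeffZ => nz.
have [/fP//|/mcoeff_outdom uP] := boolP (u \in msupp P).
have [/fQ//|/mcoeff_outdom uQ] := boolP (u \in msupp Q).
by rewrite uP uQ mulr0 addr0 eqxx in nz.
Qed.

Lemma fil0 d : fil d 0.
Proof. by move=> u; rewrite msupp0. Qed.

Lemma filZ d c P : fil d P -> fil d (c *: P).
Proof. by move=> fP; rewrite -[_ *: _]addr0; apply/filP/fil0. Qed.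

Lemma filD d P Q : fil d P -> fil d Q -> fil d (P + Q).
Proof. by move=> fP fQ; rewrite -[P]scale1r; apply: filP. Qed.

Lemma filB d P Q : fil d P -> fil d Q -> fil d (P - Q).
Proof. by move=> fP fQ; rewrite addrC -scaleN1r; apply: filP. Qed.

Lemma fil_sum d (I : Type) (r : seq I) (p : pred I) (F : I -> W K) :
  (forall i, p i -> fil d (F i)) -> fil d (\sum_(i <- r | p i) F i).
Proof. by move=> fF; apply: big_ind => //; [apply: fil0|apply: filD]. Qed.

Lemma filW d e P : d <= e -> fil d P -> fil e P.
Proof. by move=> de fP u /fP /le_trans; apply. Qed.

Lemma filU d c u : deg u <= d -> fil d << c *g u >>.
Proof.
move=> ud w; rewrite msuppU; case: ifP => // _.
by rewrite in_fset1 => /eqP ->.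
Qed.

Lemma fil_ind d (T : W K -> Prop) :
  T 0 -> (forall c P Q, T P -> T Q -> T (c *: P + Q)) ->
  (forall u, deg u <= d -> T << u >>) -> forall P, fil d P -> T P.
Proof.
move=> T0 TD TU P fP; rewrite [P]monalgE big_seq.
apply: big_ind => // [A B TA TB|u uP]; first by rewrite -[A]scale1r; apply: TD.
by rewrite malgUZ -[_ *: _]addr0; apply: TD => //; apply/TU/fP.
Qed.

Lemma polU d c u :
  pol d << c *g u >> = if deg u == d then c *: 'X^(u.2) else 0.
Proof.
by rewrite malgUZ linearZ /= /pol lextU; case: ifP => _ //; rewrite scaler0.
Qed.

(** The degree and the exponent of y determine the key ([deg_inj]), so setting x = 1 merges no two
    terms of degree [d]. *)
Lemma coef_pol d P u : deg u = d -> (pol d P)`_u.2 = P@_u.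
Proof.
move=> du; rewrite /pol /lext coef_sum.
have E w : (P@_w *: (if deg w == d then 'X^(w.2) else 0))`_u.2 =
           if w == u then P@_u else 0.
  have [->|wu] := eqVneq w u; first by rewrite du eqxx coefZ coefXn eqxx mulr1.
  case: eqP => dw; rewrite coefZ ?coef0 ?mulr0 // coefXn.
  case: eqP => [uw|_]; last by rewrite mulr0.
  case/eqP: wu; case: u w uw du dw {P} => [i j] [i' j'] /= -> <- E.
  by rewrite (deg_inj E).
under eq_bigr => w _ do rewrite E.
rewrite -big_mkcond; have [uP|uP] := boolP (u \in msupp P).
  by rewrite -big_filter filter_pred1_uniq ?fset_uniq // big_seq1.
by rewrite big_seq_cond big1 ?mcoeff_outdom.
Qed.

Lemma coef_pol_notin d P j : (forall i, deg (i, j) != d) -> (pol d P)`_j = 0.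
Proof.
move=> nd; rewrite /pol /lext coef_sum big1 // => -[i k] _ /=.
case: eqP => dw; rewrite coefZ ?coef0 ?mulr0 // coefXn.
case: eqP => [jk|_]; last by rewrite mulr0.
by have := nd i; rewrite jk dw eqxx.
Qed.

Lemma fil_pol_gt d e P : fil d P -> d < e -> pol e P = 0.
Proof.
move=> fP de; rewrite /pol /lext big_seq big1 // => u /fP ud.
by rewrite lt_eqF ?scaler0 //; apply: le_lt_trans de.
Qed.

Lemma fil_pol0 d P : fil d P -> pol d P = 0 -> fil (d - 1) P.
Proof.
move=> fP pP u uP; have := fP _ uP; rewrite le_eqVlt => /orP[/eqP du|].
  2: by rewrite -ltzD1 subrK.
by have := coef_pol P du; rewrite pP coef0 => /esym/eqP; rewrite mcoeff_eq0 uP.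
Qed.

Lemma pol_neq0 d P u : u \in msupp P -> deg u = d -> pol d P != 0.
Proof.
move=> uP du; apply/eqP => pP; have := coef_pol P du.
by rewrite pP coef0 => /esym/eqP; rewrite mcoeff_eq0 uP.
Qed.

Lemma pol_eq0P d P : pol d P != 0 -> exists2 u, u \in msupp P & deg u = d.
Proof.
move=> nz; have [/hasP[u uP /eqP du]|/hasPn nu] :=
  boolP (has (fun u => deg u == d) (msupp P)); first by exists u.
case/eqP: nz; rewrite /pol /lext big_seq big1 // => u /nu /negPf ->.
by rewrite scaler0.
Qed.

Lemma deg_mul u w (k : nat) : (k <= u.2)%N ->
  deg (u.1 + w.1 - (k * l)%N%:Z, (u.2 + w.2 - k)%N) =
  deg u + deg w - k%:Z * hdeg.
Proof.
move=> ku; rewrite /deg /hdeg /=.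
have -> : (l * (u.2 + w.2 - k))%N%:Z = l%:Z * (u.2%:Z + w.2%:Z - k%:Z).
  by rewrite PoszM -PoszD -subzn //; lia.
by rewrite !PoszM; ring.
Qed.

(** Each contraction lowers the degree by [hdeg]: the term k = 0 is the commutative product, and k =
    1 alone contributes to the degree just [hdeg] below, where the Poisson bracket lives. *)
Lemma bas_rec u w : exists2 S : W K,
    bas K l u w = << (u.1 + w.1, (u.2 + w.2)%N) >> + S &
    fil (deg u + deg w - hdeg) S /\
    pol (deg u + deg w - hdeg) S =
      (u.2%:R * (w.1%:~R / l%:R)) *: 'X^((u.2 + w.2).-1).
Proof.
pose t (k : nat) : W K := << 'C(u.2, k)%:R * ffact K l w.1 k
      *g (u.1 + w.1 - (k * l)%N%:Z, (u.2 + w.2 - k)%N) >>.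
have h0 := hdeg_gt0; exists (\sum_(k < u.2) t k.+1).
  rewrite /bas -/(t _) (eq_bigr (fun k : 'I_u.2.+1 => t k)) // big_ord_recl.
  rewrite {1}/t bin0 mul1r /ffact big_ord0 mul0n subr0 subn0.
  by congr (_ + _); apply: eq_bigr => k _; rewrite lift0.
split.
  apply: fil_sum => k _; apply: filU.
  rewrite deg_mul ?ltn_ord //; nia.
rewrite linear_sum /=.
have [u0|u_gt0] := posnP u.2.
  by rewrite u0 big_ord0 mul0r scale0r.
rewrite (bigD1 (Ordinal u_gt0)) //= big1 => [|k k0].
  rewrite polU deg_mul // mul1r eqxx bin1 addr0 /ffact big_ord1 subr0.
  by rewrite subn1.
rewrite polU deg_mul ?ltn_ord //.
have {}k0 : (0 < k)%N by rewrite lt0n; apply: contraNneq k0 => k0; apply/eqP/val_inj.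
by case: eqP => // E; exfalso; nia.
Qed.

(** By bilinearity it suffices to multiply basis elements, where only the term k = 0 can reach
    degree [d + e]. *)
Lemma wmul_fil_pol d e P R : fil d P -> fil e R ->
  fil (d + e) (wmul l P R) /\ pol (d + e) (wmul l P R) = pol d P * pol e R.
Proof.
move=> fP; move: P fP R; have h0 := hdeg_gt0.
apply: fil_ind => [|c P Q IP IQ|u ud] R fR.
- rewrite (wmul0l charK l_gt0). rewrite !pol0 mul0r; split=> //; exact: fil0.
- have [[fP pP] [fQ pQ]] := (IP _ fR, IQ _ fR).
  rewrite (wmulPl charK l_gt0) !polP [X in _ = X]mulrDl -scalerAl -pP -pQ; split; first exact: filP.
  by [].
move: R fR; apply: fil_ind => [|c P Q [fP pP] [fQ pQ]|w we].
- rewrite (wmul0r charK l_gt0) !pol0 mulr0; split=> //; exact: fil0.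
- rewrite (wmulPr charK l_gt0) !polP [X in _ = X]mulrDr -scalerAr -pP -pQ; split; first exact: filP.
  by [].
rewrite wmulU //; have [S -> [fS pS]] := bas_rec u w.
have D : deg (u.1 + w.1, (u.2 + w.2)%N) = deg u + deg w.
  by have := @deg_mul u w 0 isT; rewrite mul0n subr0 subn0 mul0r subr0.
split.
  by apply: filD; [apply: filU; rewrite D; lia|apply: filW fS; lia].
rewrite linearD /= (fil_pol_gt fS) ?addr0; last lia.
rewrite !polU D !scale1r.
have [->|ud'] := eqVneq (deg u) d; last by rewrite mul0r ifF //; lia.
have [->|we'] := eqVneq (deg w) e; last by rewrite mulr0 ifF //; lia.
by rewrite eqxx -exprD.
Qed.

(** On basis elements the terms k = 0 of the two products cancel, and the terms k = 1 leave the
    coefficient (u.2 w.1 - w.2 u.1) / l. Times rho l, this is u.2 deg(w) - w.2 deg(u), because the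
    contributions of sigma cancel. *)
Lemma wbr_fil_pol d e P R : fil d P -> fil e R ->
  fil (d + e - hdeg) (wbr l P R) /\
  (rho * l%:Z)%:~R * pol (d + e - hdeg) (wbr l P R) = pbr d e (pol d P) (pol e R).
Proof.
move=> fP; move: P fP R; have h0 := hdeg_gt0.
apply: fil_ind => [|c P Q IP IQ|u ud] R fR.
- rewrite (wbr0l charK l_gt0) !pol0 pbr0l mulr0; split=> //; exact: fil0.
- have [[fP pP] [fQ pQ]] := (IP _ fR, IQ _ fR).
  rewrite (wbrPl charK l_gt0) !polP; split; first exact: filP.
  by rewrite pbrDl -pP -pQ mul_poly_linear.
move: R fR; apply: fil_ind => [|c P Q [fP pP] [fQ pQ]|w we].
- rewrite (wbr0r charK l_gt0) !pol0 pbr0r mulr0; split=> //; exact: fil0.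
- rewrite (wbrPr charK l_gt0) !polP; split; first exact: filP.
  by rewrite pbrDr -pP -pQ mul_poly_linear.
rewrite /wbr !wmulU //.
have [S -> [fS pS]] := bas_rec u w; have [T -> [fT pT]] := bas_rec w u.
rewrite [w.1 + _]addrC [(w.2 + _)%N]addnC opprD addrACA subrr add0r.
rewrite [deg w + _]addrC in fT pT; rewrite [(w.2 + _)%N]addnC in pT.
split; first by apply: filW (filB fS fT); lia.
have [dd|nd] := boolP ((deg u == d) && (deg w == e)); last first.
  rewrite (fil_pol_gt (filB fS fT)) ?mulr0; last by move: nd; lia.
  rewrite !polU; move: nd; rewrite negb_and => /orP[] /negPf ->.
    by rewrite pbr0l.
  by rewrite pbr0r.
case/andP: dd => /eqP <- /eqP <-; rewrite linearB /= pS pT !polU !eqxx !scale1r.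
rewrite /pbr !derivXn -!mul_polyC.
have X1 (n m : nat) : (n%:R : {poly K}) * 'X^((n + m).-1) = 'X^(n.-1) *+ n * 'X^m.
  by case: n => [|n]; rewrite ?mulr0n ?mul0r // addSn /= exprD mulr_natl mulrnAl.
have X2 (n m : nat) : (m%:R : {poly K}) * 'X^((n + m).-1) = 'X^n * ('X^(m.-1) *+ m).
  by rewrite addnC X1 mulrC.
rewrite -mulrA -X1 -mulrA -X2.
have lP : (l%:R%:P : {poly K}) * (l%:R^-1)%:P = 1.
  by rewrite -polyCM divff // lR_neq0.
rewrite /deg !intrD !intrM !polyCM !polyCMz -!pmulrn.
rewrite !polyC_natr in lP *.
rewrite !natrM.
set X := 'X^_; set li := _%:P in lP *.
set U := u.1%:~R; set Z := w.1%:~R.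
transitivity (rho%:~R * (l%:R * li) * X * (u.2%:R * Z - w.2%:R * U)); first by ring.
rewrite lP; ring.
Qed.

End Grading.

(** * The equation [e p' q - d p q' = c s] *)

Section PolyODE.
Context (K : fieldType) (charK : [pchar K] =i pred0).
Implicit Types (p q s t f : {poly K}) (a d e h c : int).

Lemma intr_eq0_pchar0 c : (c%:~R == 0 :> K) = (c == 0).
Proof.
have ch := (pcharf0P K).1 charK.
case: c => n; first by rewrite -pmulrn ch.
by rewrite NegzE mulrNz oppr_eq0 -pmulrn ch oppr_eq0.
Qed.

Lemma intr_poly c : c%:~R = (c%:~R)%:P :> {poly K}.
Proof. by rewrite polyCMz. Qed.

Lemma intr_poly_eq0 c : (c%:~R == 0 :> {poly K}) = (c == 0).
Proof. by rewrite intr_poly polyC_eq0 intr_eq0_pchar0. Qed.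

Lemma coefM_top p q m n : (size p <= m.+1)%N -> (size q <= n.+1)%N ->
  (p * q)`_(m + n) = p`_m * q`_n.
Proof.
move=> sp sq; have mm : (m < (m + n).+1)%N by rewrite ltnS leq_addr.
rewrite coefM (bigD1 (Ordinal mm)) //= addKn big1 ?addr0 // => i im.
have {im} : (i != m :> nat) by apply: contraNneq im => im; apply/eqP/val_inj.
rewrite neq_ltn => /orP[im|mi].
  by rewrite (nth_default _ (leq_trans sq _)) ?mulr0 //; lia.
by rewrite (nth_default _ (leq_trans sp mi)) mul0r.
Qed.

Lemma coefXderiv p m : ('X * p^`())`_m = p`_m *+ m.
Proof. by rewrite coefXM coef_deriv; case: m. Qed.

(* Hence the degree of [q] is determined by [e]: this replaces proportionality
   of the leading forms in the dimension count. *)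
Lemma pbr0_size a e p q : p != 0 -> q != 0 -> pbr a e p q = 0 ->
  e * (size p).-1%:Z = a * (size q).-1%:Z.
Proof.
move=> p0 q0 E; set m := (size p).-1; set n := (size q).-1.
have sp : (size p <= m.+1)%N by rewrite leqSpred.
have sq : (size q <= n.+1)%N by rewrite leqSpred.
have sX (r : {poly K}) k : (size r <= k.+1)%N -> (size ('X * r^`())%R <= k.+1)%N.
  move=> sr; apply/leq_sizeP => j kj.
  by rewrite coefXderiv nth_default ?mul0rn //; apply: leq_trans kj.
(* The factor X turns the derivative into the Euler operator, which scales the coefficient of index
   k by k. So this coefficient is e m - a n times both leading coefficients. *)
have : ('X * pbr a e p q)`_(m + n) = 0 by rewrite E mulr0 coef0.
have -> : 'X * pbr a e p q =
    e%:~R * (('X * p^`()) * q) - a%:~R * (p * ('X * q^`())) by rewrite /pbr; ring.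
rewrite coefB !intr_poly !coefCM !coefM_top ?sX // !coefXderiv.
have -> : e%:~R * (p`_m *+ m * q`_n) - a%:~R * (p`_m * (q`_n *+ n)) =
          (e * m%:Z - a * n%:Z)%:~R * (p`_m * q`_n) :> K.
  by rewrite intrB !intrM -!pmulrn -(mulr_natr _ m) -(mulr_natr _ n); ring.
move/eqP; rewrite mulf_eq0 intr_eq0_pchar0 mulf_eq0 -!lead_coefE !lead_coef_eq0.
by rewrite (negPf p0) (negPf q0) !orbF subr_eq0 => /eqP.
Qed.

Lemma poly_factor_out t p : (1 < size t)%N -> p != 0 ->
  exists k p1, p = t ^+ k * p1 /\ ~~ (t %| p1).
Proof.
move=> t1; have [n] := ubnP (size p); elim: n p => // n IH p sp p0.
have [/dvdpP[q pq]|] := boolP (t %| p); last by exists 0%N, p; rewrite mul1r.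
have q0 : q != 0 by apply: contraNneq p0; rewrite pq => ->; rewrite mul0r.
have t0 : t != 0 by rewrite -size_poly_gt0; apply: leq_trans t1.
have [|k [p1 [qE tp1]]] := IH q _ q0.
  move: sp; rewrite pq size_mul // ltnS => sp.
  apply: leq_trans sp; rewrite -(prednK (ltnW t1)) addnS /= -addn1 leq_add2l.
  by rewrite -ltnS prednK //; apply: ltnW.
by exists k.+1, p1; split=> //; rewrite pq qE exprS mulrC mulrA.
Qed.

(** Irreducibility over an arbitrary field is not decidable in general, hence the classical case
    distinction. *)
Lemma irreducible_factor p : (1 < size p)%N ->
  exists2 t, irreducible_poly t & t %| p.
Proof.
have [n] := ubnP (size p); elim: n p => // n IH p sp p1.
have p0 : p != 0 by rewrite -size_poly_gt0; apply: leq_trans p1.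
have [|nirr] := Classical_Prop.classic (irreducible_poly p); first by exists p.
have [q [q1 qp neq]] : exists q, [/\ size q != 1%N, q %| p & ~~ (q %= p)].
  apply: Classical_Prop.NNPP => nex; apply: nirr; split=> // q q1 qp.
  by apply/negPn/negP => neq; apply: nex; exists q.
have q0 : q != 0 by apply: contraNneq p0 => q0; rewrite q0 dvd0p in qp.
have sqp : (size q < size p)%N.
  rewrite ltn_neqAle dvdp_leq // andbT.
  by apply: contraNN neq; rewrite dvdp_size_eqp.
have [||t irt tq] := IH q.
- by apply: leq_trans sqp _; rewrite -ltnS.
- by rewrite -size_poly_gt0 in q0; lia.
by exists t => //; apply: dvdp_trans qp.
Qed.

Lemma irreducible_coprimep t p : irreducible_poly t -> ~~ (t %| p) ->
  coprimep t p.
Proof.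
move=> irt tp; apply/coprimepP => d dt dp.
have [//|dt'] := irredp_XsubCP irt dt.
by case/negP: tp; rewrite -(eqp_dvdl _ dt').
Qed.

(** The full power of one irreducible factor of [s] is coprime to the cofactor, to which the
    induction applies. *)
Lemma dvdp_irreducible s p : s != 0 ->
  (forall t k, irreducible_poly t -> t ^+ k %| s -> t ^+ k %| p) -> s %| p.
Proof.
have [n] := ubnP (size s); elim: n s => // n IH s ss s0 H.
have [s1|s1] := leqP (size s) 1.
  have : size s == 1%N by rewrite -size_poly_gt0 in s0; lia.
  by rewrite size_poly_eq1 => /eqp_dvdl ->; apply: dvd1p.
have [t irt ts] := irreducible_factor s1.
have [k [s' [sE ts']]] := poly_factor_out irt.1 s0.
have s'0 : s' != 0 by apply: contraNneq s0 => s'0; rewrite sE s'0 mulr0.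
have cop := coprimep_expl k (irreducible_coprimep irt ts').
rewrite sE Gauss_dvdp // H ?sE ?dvdp_mulr //=; apply: IH => //.
  case: k sE {cop} => [|k] sE; first by rewrite mul1r in sE; rewrite sE (negPf ts') in ts.
  rewrite -ltnS; apply: leq_trans ss; rewrite ltnS sE.
  have tk0 : t ^+ k.+1 != 0 by rewrite expf_neq0 // irredp_neq0.
  rewrite size_mul // -(prednK (_ : 0 < size (t ^+ k.+1)))%N ?size_poly_gt0 //.
  rewrite addSn /= -[X in (X < _)%N]add0n ltn_add2r size_exp muln_gt0 andbT.
  by have := irt.1; lia.
by move=> r j irr rs'; apply: H => //; rewrite sE dvdp_mull.
Qed.

(* Multiplied by [t] to avoid the exponents [i - 1] and [j - 1]. *)
Lemma mul_pbr_exp t d e i j p q :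
  t * pbr d e (t ^+ i * p) (t ^+ j * q) = t ^+ (i + j) *
    ((e * i%:Z - d * j%:Z)%:~R * t^`() * (p * q) + t * pbr d e p q).
Proof.
have tX k : t * (t ^+ k)^`() = k%:R * t^`() * t ^+ k.
  rewrite deriv_exp; case: k => [|k]; first by rewrite mulr0n mulr0 !mul0r.
  by rewrite /= mulrnAr mulrCA -exprS -mulrA mulr_natl.
rewrite /pbr !derivM intrB !intrM -!pmulrn exprD.
transitivity (e%:~R * ((t * (t ^+ i)^`()) * p + t * t ^+ i * p^`()) * (t ^+ j * q)
  - d%:~R * (t ^+ i * p) * ((t * (t ^+ j)^`()) * q + t * t ^+ j * q^`())).
  by ring.
by rewrite !tX; ring.
Qed.

(** In characteristic zero the derivative of [t] is nonzero and of smaller size, so [t] cannot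
    divide it. *)
Lemma irreducible_ndvd_deriv t c p q : irreducible_poly t -> ~~ (t %| p) ->
  ~~ (t %| q) -> t %| c%:~R * t^`() * (p * q) -> c = 0.
Proof.
move=> irt tp tq; rewrite Gauss_dvdpl; last first.
  by rewrite coprimepMr !irreducible_coprimep.
have t'0 : t^`() != 0.
  apply/eqP => t'0; have := coefXderiv t (size t).-1.
  rewrite t'0 mulr0 coef0 -lead_coefE -mulr_natr => /esym/eqP.
  rewrite mulf_eq0 lead_coef_eq0 (negPf (irredp_neq0 irt)) /=.
  by have := irt.1; case: (size t) => [|[|n]] // _; rewrite (negPf (natr_neq0 charK _)).
have [//|c0] := eqVneq c 0.
rewrite intr_poly mul_polyC dvdpZr ?intr_eq0_pchar0 // => /dvdp_leq.
by move=> /(_ t'0); rewrite leqNgt lt_size_deriv // irredp_neq0.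
Qed.

(** Let i, j, m be the multiplicities of an irreducible [t] in [p], [q], [s]. If i + j < m, the
    lowest order in [t] of the two equations gives (a + e - h) i = a m and e i = a j, hence h i = a
    (i + j - m) < 0, which is absurd. *)
Lemma pbr_dvd a e h c p q s : 0 < a -> 0 < h -> p != 0 -> q != 0 -> s != 0 ->
  pbr a (a + e - h) p s = 0 -> pbr a e p q = c%:~R * s -> s %| p * q.
Proof.
move=> a0 h0 p0 q0 s0 E1 E2; apply: dvdp_irreducible => // t k irt ks.
have tE n : t ^+ n != 0 by rewrite expf_neq0 // irredp_neq0.
have [i [p1 [pE tp1]]] := poly_factor_out irt.1 p0.
have [j [q1 [qE tq1]]] := poly_factor_out irt.1 q0.
have [m [s1 [sE ts1]]] := poly_factor_out irt.1 s0.
have km : (k <= m)%N.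
  rewrite -(dvdp_Pexp2l _ _ irt.1) -(@Gauss_dvdpl _ _ s1) -?sE //.
  by apply/coprimep_expl/irreducible_coprimep.
apply: (@dvdp_trans _ (t ^+ (i + j))); last first.
  by rewrite exprD pE qE dvdp_mul ?dvdp_mulr.
apply: dvdp_exp2l; apply: leq_trans km _; rewrite leqNgt; apply/negP => ijm.
have F1 : (a + e - h) * i%:Z = a * m%:Z.
  apply/eqP; rewrite -subr_eq0; apply/eqP.
  apply: (@irreducible_ndvd_deriv t _ p1 s1) => //.
  have := mul_pbr_exp t a (a + e - h) i m p1 s1; rewrite -pE -sE E1 mulr0.
  move/esym/eqP; rewrite mulf_eq0 (negPf (tE _)) /= addr_eq0 => /eqP ->.
  by rewrite dvdpNr dvdp_mulr.
have F2 : e * i%:Z = a * j%:Z.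
  apply/eqP; rewrite -subr_eq0; apply/eqP.
  apply: (@irreducible_ndvd_deriv t _ p1 q1) => //.
  have := mul_pbr_exp t a e i j p1 q1; rewrite -pE -qE E2 sE.
  have -> : t * (c%:~R * (t ^+ m * s1)) =
            t ^+ (i + j) * (t * (c%:~R * (t ^+ (m - (i + j)) * s1))).
    by rewrite -{1}(subnKC (ltnW ijm)) exprD; ring.
  move/(mulfI (tE _))/eqP; rewrite -subr_eq => /eqP <-.
  by rewrite dvdp_sub ?dvdp_mulr.
nia.
Qed.

(** As [s] commutes with [p], the Leibniz rule gives {p, p q / s} = p {p, q} / s. The proof carries
    this out multiplied by [s]. *)
Lemma pbr_solve a e h c p q s : 0 < a -> 0 < h -> p != 0 -> q != 0 -> s != 0 ->
  pbr a (a + e - h) p s = 0 -> pbr a e p q = c%:~R * s ->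
  exists2 f, f * s = p * q & pbr a h p f = c%:~R * p.
Proof.
move=> a0 h0 p0 q0 s0 E1 E2.
have /dvdpP[f fE] := pbr_dvd a0 h0 p0 q0 s0 E1 E2.
exists f => //; apply: (mulIf s0).
have D : f^`() * s = p^`() * q + p * q^`() - f * s^`().
  by rewrite -derivM fE derivM addrK.
move: E1 E2; rewrite /pbr !intrD intrN => /eqP; rewrite subr_eq0 => /eqP E1 E2.
transitivity (h%:~R * p^`() * (f * s) - a%:~R * p * (f^`() * s)); first by ring.
rewrite D.
transitivity (h%:~R * p^`() * (f * s) - a%:~R * p * (p^`() * q + p * q^`())
   + f * (a%:~R * p * s^`())); first by ring.
rewrite -E1.
transitivity (h%:~R * p^`() * (f * s) - a%:~R * p * (p^`() * q + p * q^`())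
   + (a%:~R + e%:~R - h%:~R) * p^`() * (f * s)); first by ring.
transitivity (p * (c%:~R * s)); last by ring.
by rewrite -E2 -fE; ring.
Qed.

(** Commuting with [p] means a p q' = b p' q: formally [q] is a constant times p^(b/a), and it
    inherits the equation with the factor b/a. *)
Lemma pbr_transfer a b h c p q f : p != 0 ->
  pbr a b p q = 0 -> pbr a h p f = c%:~R * p ->
  a%:~R * pbr b h q f = b%:~R * c%:~R * q.
Proof.
move=> p0 E1 E2; apply: (mulIf p0).
move: E1 E2; rewrite /pbr => /eqP; rewrite subr_eq0 => /eqP E1 E2.
transitivity (h%:~R * f * (a%:~R * p * q^`()) - b%:~R * q * (a%:~R * p * f^`())).
  by ring.
rewrite -E1.
transitivity (b%:~R * q * (h%:~R * p^`() * f - a%:~R * p * f^`())); first by ring.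
by rewrite E2; ring.
Qed.

(** Let k be the order of [f] at 0. If a = h j, the term of order j + k - 1 of the bracket carries
    the factor h j - a k = a (1 - k). So the order of the bracket is j - 1 for k = 0 and exceeds j
    for k > 0, while the right-hand side has order j. *)
Lemma pbr_order0 a h c j p f : 0 < a -> c != 0 -> f != 0 -> ~~ ('X %| p) ->
  pbr a h ('X^j * p) f = c%:~R * ('X^j * p) -> a <> h * j%:Z.
Proof.
move=> a0 c0 f0 Xp E aE.
have irX : irreducible_poly ('X : {poly K}).
  by have := irredp_XaddC (0 : K); rewrite polyC0 addr0.
have [k [f1 [fE Xf1]]] := poly_factor_out irX.1 f0.
have := mul_pbr_exp 'X a h j k p f1; rewrite -fE E -aE.
have cu (r : {poly K}) : ('X %| c%:~R * r) = ('X %| r).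
  by rewrite intr_poly mul_polyC dvdpZr ?intr_eq0_pchar0.
have X0 n : ('X^n : {poly K}) != 0 by rewrite expf_neq0 // polyX_eq0.
case: k fE => [|k] fE.
  have -> : 'X * (c%:~R * ('X^j * p)) = 'X^j * ('X * (c%:~R * p)) by ring.
  rewrite addn0 mulr0 subr0 => /(mulfI (X0 _)) H.
  have : a = 0 by apply: (irreducible_ndvd_deriv irX Xp Xf1);
    rewrite -[_ * (p * f1)](addrK ('X * pbr a h p f1)) -H dvdp_sub ?dvdp_mulr.
  by move=> a'; rewrite a' in a0.
have -> : 'X * (c%:~R * ('X^j * p)) = 'X^(j + 1) * (c%:~R * p).
  by rewrite exprD expr1; ring.
have -> : 'X^(j + k.+1) = 'X^(j + 1) * 'X^k :> {poly K}.
  by rewrite -exprD addn1 addnS.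
rewrite -[RHS]mulrA => /(mulfI (X0 _)) H.
case/negP: Xp; rewrite -cu H; case: k {fE} H => [|k] _; last first.
  by rewrite exprS -mulrA dvdp_mulr.
by rewrite mulr1 subrr mul1r mulr0z !mul0r add0r dvdp_mulr.
Qed.

End PolyODE.

(** * An element whose leading form does not commute with that of [P] *)

Section Counting.
Context (K : fieldType) (charK : [pchar K] =i pred0).
Context (l : nat) (rho sigma : int).
Context (rho_gt0 : 0 < rho).
Context (a b h kappa : int) (p : {poly K}) (D : {linear W K -> W K}).
Context (bb : nat -> nat -> W K).
Local Notation fil := (@fil K l rho sigma).
Local Notation pol := (@pol K l rho sigma).
Hypotheses (a_gt0 : 0 < a) (b_ge0 : 0 <= b) (h_gt0 : 0 < h).
Hypotheses (p_neq0 : p != 0).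
Hypothesis D_fil : forall e R, fil e R -> fil (a + e - h) (D R).
Hypothesis D_pol : forall e R, fil e R ->
  kappa%:~R * pol (a + e - h) (D R) = pbr a e p (pol e R).
Hypothesis D_bb0 : forall i, D (bb i 0) = 0.
Hypothesis D_bbS : forall i j, D (bb i j.+1) = - j.+1%:R *: bb i j.
Hypothesis fil_bb : forall i j, fil (a * i%:Z + b * j%:Z) (bb i j).
Hypothesis pol_bb : forall i, pol (a * i%:Z) (bb i 0) = p ^+ i.

(** Throughout this section [D] stands for ad P, [bb i j] for P^i Q^j, [p] for the leading form of P
    and [kappa] for rho l. *)
Definition comb I J (c : nat -> nat -> K) : W K :=
  \sum_(i < I) \sum_(j < J) c i j *: bb i j.

Lemma D_comb I J c :
  D (comb I J.+1 c) = comb I J (fun i j => - j.+1%:R * c i j.+1).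
Proof.
rewrite /comb linear_sum; apply: eq_bigr => i _.
rewrite linear_sum big_ord_recl [X in X + _]linearZZ D_bb0 scaler0 add0r.
apply: eq_bigr => j _; rewrite linearZZ D_bbS scalerA lift0; congr (_ *: _).
by rewrite mulrC.
Qed.

(** The leading forms p^i are nonzero of distinct degrees a i >= 0, so the highest term cannot
    cancel. *)
Lemma fil_neg_powers I (c : nat -> K) d : d < 0 ->
  fil d (\sum_(i < I) c i *: bb i 0) -> forall i, (i < I)%N -> c i = 0.
Proof.
move=> d0; elim: I => [|I IH] // fS.
have cI : c I = 0.
  have : pol (a * I%:Z) (\sum_(i < I.+1) c i *: bb i 0) = 0.
    by apply: (fil_pol_gt fS); nia.
  rewrite big_ord_recr linearD linearZ /= pol_bb linear_sum big1 => [|i _].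
    move/eqP; rewrite add0r scaler_eq0 expf_eq0 (negPf p_neq0) andbF orbF.
    by move/eqP.
  rewrite linearZ /= (fil_pol_gt (@fil_bb i 0)) ?scaler0 //.
  by have := ltn_ord i; nia.
move=> i; rewrite ltnS leq_eqVlt => /predU1P[->//|]; apply: IH.
by move: fS; rewrite big_ord_recr /= cI scale0r addr0.
Qed.

(** Applying [D] kills the terms with j = 0, lowers the other j by one and raises the degree by less
    than [a], so induction makes the coefficients with j > 0 vanish. A polynomial in P remains. *)
Lemma fil_neg_comb I J c d : fil d (comb I J c) -> d < - (a * J%:Z) ->
  forall i j, (i < I)%N -> (j < J)%N -> c i j = 0.
Proof.
elim: J c d => [|J IH] c d fc dJ i j // iI.
have cS i' j' : (i' < I)%N -> (j' < J)%N -> c i' j'.+1 = 0.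
  move=> iI' jJ; have fD : fil (d + a) (D (comb I J.+1 c)).
    by apply: filW (D_fil fc); lia.
  have lt : d + a < - (a * J%:Z) by nia.
  rewrite D_comb in fD; have /eqP := IH _ _ fD lt i' j' iI' jJ.
  by rewrite mulf_eq0 oppr_eq0 (negPf (natr_neq0 charK _)) /= => /eqP.
case: j => [_|j jJ]; last exact: cS.
apply: (@fil_neg_powers I (fun i => c i 0%N) d) => //; first by nia.
congr (fil d _): fc; apply: eq_bigr => k _.
rewrite big_ord_recl big1 ?addr0 // => j _.
by rewrite lift0 cS ?scale0r.
Qed.

(** If the first alternative fails, induct on [J]: [D] turns a combination into one with fewer
    powers of Q, whose component commutes with [p] by induction and would therefore be a forbidden s
    unless it is 0. *)
Lemma second_bracket_dichotomy :
  (exists R e, [/\ fil e R, pol (a + e - h) (D R) != 0 &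
     pbr a (a + e - h) p (pol (a + e - h) (D R)) = 0]) \/
  (forall I J c e, fil e (comb I J c) -> pbr a e p (pol e (comb I J c)) = 0).
Proof.
have [|nR] := Classical_Prop.classic (exists R e, [/\ fil e R,
   pol (a + e - h) (D R) != 0 &
   pbr a (a + e - h) p (pol (a + e - h) (D R)) = 0]); first by left.
right=> I J; elim: J => [|J IH] c e fc.
  rewrite /comb big1 ?linear0 ?pbr0r // => i _; exact: big_ord0.
have [E|nz] := eqVneq (pol (a + e - h) (D (comb I J.+1 c))) 0.
  by rewrite -D_pol // E mulr0.
case: nR; exists (comb I J.+1 c), e; split=> //.
by rewrite D_comb; apply: IH; rewrite -D_comb; apply: D_fil.
Qed.

(** * Lowering the degree by linear elimination *)

Section Elimination.
Context (I J : nat).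
Hypothesis comm : forall c e, fil e (comb I.+1 J.+1 c) ->
  pbr a e p (pol e (comb I.+1 J.+1 c)) = 0.

(** Matrices of coefficients form a space whose dimension can be counted; [inord] is needed because
    [comb] is indexed by [nat]. *)
Definition mcomb (M : 'M[K]_(I.+1, J.+1)) : W K :=
  comb I.+1 J.+1 (fun i j => M (inord i) (inord j)).

Lemma mcomb_is_linear : linear mcomb.
Proof.
move=> c M N; rewrite /mcomb /comb scaler_sumr -big_split.
apply: eq_bigr => i _; rewrite scaler_sumr -big_split.
by apply: eq_bigr => j _; rewrite /= !mxE scalerDl scalerA.
Qed.
HB.instance Definition _ := GRing.isLinear.Build K 'M[K]_(I.+1, J.+1) (W K)
  *:%R mcomb mcomb_is_linear.

Definition mcoef e t (M : 'M[K]_(I.+1, J.+1)) : K^o := (pol e (mcomb M))`_t.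
Lemma mcoef_is_linear e t : linear (mcoef e t).
Proof. by move=> c M N; rewrite /mcoef !linearP coefD coefZ. Qed.
HB.instance Definition _ e t := GRing.isLinear.Build K 'M[K]_(I.+1, J.+1) K^o
  *:%R (mcoef e t) (mcoef_is_linear e t).

(** By [pbr0_size], all nonzero components of degree [e] have the same degree t in y. Killing the
    coefficient of y^t therefore kills the component, so each degree costs at most one dimension. *)
Lemma low_degree_elt k (lo : int) (V : {vspace 'M[K]_(I.+1, J.+1)}) : (k < \dim V)%N ->
  (forall M, M \in V -> fil (lo + k%:Z) (mcomb M)) ->
  exists2 M, M != 0 & fil lo (mcomb M).
Proof.
elim: k V => [|k IH] V dV fV.
  exists (vpick V); first by rewrite vpick0 -dimv_eq0 -lt0n.
  by move: (fV _ (memv_pick V)); rewrite addr0.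
have [fV'|] := Classical_Prop.classic
    (forall M, M \in V -> fil (lo + k%:Z) (mcomb M)).
  by apply: (IH V) => //; apply: ltnW.
move=> nfV; have [M0 M0V nM0] : exists2 M, M \in V & ~ fil (lo + k%:Z) (mcomb M).
  apply: Classical_Prop.NNPP => nex; apply: nfV => M MV.
  by apply: Classical_Prop.NNPP => nM; apply: nex; exists M.
set e := lo + k.+1%:Z in fV.
have ek : e - 1 = lo + k%:Z by rewrite /e; lia.
have p0 : pol e (mcomb M0) != 0.
  by apply/eqP => E; apply: nM0; rewrite -ek; exact: (fil_pol0 rho_gt0 (fV _ M0V) E).
set t := (size (pol e (mcomb M0))).-1.
pose f := linfun (mcoef e t).
apply: (IH (V :&: lker f)%VS).
  have f1 : (\dim (f @: V) <= 1)%N.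
    by apply: leq_trans (dimvS (subvf _)) _; rewrite dimvf.
  rewrite -(limg_ker_dim f V) in dV.
  by rewrite -ltnS -(addn1 (\dim _)); apply: leq_trans dV _; rewrite leq_add2l.
move=> M; rewrite memv_cap memv_ker lfunE /= => /andP[MV /eqP fM].
rewrite -ek; apply: (fil_pol0 rho_gt0 (fV _ MV)); apply/eqP/negPn/negP => nz.
have S0 := pbr0_size charK p_neq0 p0 (comm (fV _ M0V)).
have S1 := pbr0_size charK p_neq0 nz (comm (fV _ MV)).
have tE : (size (pol e (mcomb M))).-1 = t.
  have inj (m n : nat) : a * m%:Z = a * n%:Z -> m = n.
    by move=> /(mulfI (lt0r_neq0 a_gt0)) [].
  exact: inj (etrans (esym S1) S0).
by move: nz; rewrite -lead_coef_eq0 lead_coefE tE -/(mcoef e t M) fM eqxx.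
Qed.

End Elimination.

Lemma exists_second_bracket : exists R e, [/\ fil e R,
  pol (a + e - h) (D R) != 0 &
  pbr a (a + e - h) p (pol (a + e - h) (D R)) = 0].
Proof.
have [//|comm] := second_bracket_dichotomy.
have [a' aE] : exists n : nat, a = n%:Z by exists `|a|%N; lia.
have [b' bE] : exists n : nat, b = n%:Z by exists `|b|%N; lia.
(* chosen so that [I.+1 * J.+1] exceeds the number of degrees left *)
pose J := a'; pose I := (J.+1 * (a' + b')).+1.
pose k := (I.+1 * a' + J.+1 * b' + J.+1 * a').+1.
(* The target degree is just below the threshold of [fil_neg_comb]; adding [k] gives
   [I.+1 * a' + J.+1 * b'], which bounds all degrees. Here [k] equals [I.+1 * a' + I], one less than
   the dimension. *)
have [||M M0 fM] := @low_degree_elt I J (comm I.+1 J.+1) k (- (a * J.+1%:Z) - 1) fullv.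
- by rewrite dimvf dim_matrix /k /I /J; nia.
- move=> M _; apply: fil_sum => i _; apply: fil_sum => j _; apply: filZ.
  apply: filW (@fil_bb i j); rewrite /k aE bE.
  have : (a' * i <= I.+1 * a')%N by rewrite mulnC leq_mul2r (ltnW (ltn_ord i)) orbT.
  have : (b' * j <= J.+1 * b')%N by rewrite mulnC leq_mul2r (ltnW (ltn_ord j)) orbT.
  lia.
case/eqP: M0; apply/matrixP => i j; rewrite mxE.
have lo : - (a * J.+1%:Z) - 1 < - (a * J.+1%:Z) by lia.
by have := fil_neg_comb fM lo (ltn_ord i) (ltn_ord j); rewrite !inord_val.
Qed.

End Counting.

(** * Valuations and homogeneous lifts *)

Lemma bigmax_mem (T : eqType) (f : T -> rat) x0 (s : seq T) :
  exists2 u, u \in x0 :: s & \big[Num.max/f x0]_(u <- s) f u = f u.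
Proof.
elim: s => [|x s [u us E]]; first by exists x0; rewrite ?big_nil ?mem_head.
rewrite big_cons E; have [_|_] := leP (f x) (f u).
  by exists u => //; move: us; rewrite !inE => /orP[->|->]; rewrite ?orbT.
by exists x => //; rewrite !inE eqxx orbT.
Qed.

Lemma head_mem (T : eqType) x0 (s : seq T) : s != [::] -> head x0 s \in s.
Proof. by case: s => // x s _; apply: mem_head. Qed.

Lemma argmax_seq_mem (T : eqType) (f : T -> rat) x0 (s : seq T) :
  s != [::] -> argmax_seq f x0 s \in s.
Proof.
have foldl_mem (r : seq T) x :
    foldl (fun m y => if f m < f y then y else m) x r \in x :: r.
  elim: r x => [|y r IH] x /=; first exact: mem_head.
  have := IH (if f x < f y then y else x); rewrite !inE.
  by case: ifP => _ /orP[] ->; rewrite ?orbT.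
case: s => // x s _; rewrite /argmax_seq /= ltxx; exact: foldl_mem.
Qed.

(** [ratr] uses the reduced fraction; cross-multiplication is legitimate because nonzero integers
    stay nonzero in [K]. *)
Lemma ratr_frac (K : fieldType) (charK : [pchar K] =i pred0) (b a : int) :
  a != 0 -> ratr (b%:~R / a%:~R) = b%:~R / a%:~R :> K.
Proof.
move=> a0; rewrite /ratr; set x := b%:~R / a%:~R.
have d0 := denq_neq0 x.
have E : numq x * a = b * denq x.
  apply/eqP; rewrite -(eqr_int rat) !intrM numqE /x mulrAC divfK ?intr_eq0 //.
apply/eqP; rewrite eqr_div ?intr_eq0_pchar0 //.
by rewrite -!intrM E.
Qed.

Section Leading.
Context (K : fieldType) (l : nat) (l_gt0 : (0 < l)%N) (rho sigma : int).
Context (rho_gt0 : 0 < rho).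
Implicit Types (P Q R : W K) (u w : expo) (d e : int).
Local Notation deg := (deg l rho sigma).
Local Notation fil := (@fil K l rho sigma).
Local Notation pol := (@pol K l rho sigma).

Lemma vpt_deg u : vpt l rho sigma u = (deg u)%:~R / l%:R.
Proof.
have l0 : l%:R != 0 :> rat by rewrite pnatr_eq0 -lt0n.
rewrite /vpt /deg intrD !intrM -!pmulrn natrM mulrDl; congr (_ + _).
  by rewrite mulrA.
by rewrite -mulrA; congr (_ * _); rewrite mulrAC divff ?mul1r.
Qed.

Lemma le_vpt_deg u d : (vpt l rho sigma u <= d%:~R / l%:R) = (deg u <= d).
Proof. by rewrite vpt_deg ler_pM2r ?invr_gt0 ?ltr0n // ler_int. Qed.

Lemma eq_vpt_deg u d : (vpt l rho sigma u == d%:~R / l%:R) = (deg u == d).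
Proof.
rewrite vpt_deg (inj_eq (mulIf _)) ?eqr_int //.
by rewrite invr_eq0 pnatr_eq0 -lt0n.
Qed.

Lemma msupp_neq0 P : P != 0 -> (msupp P : seq expo) != [::].
Proof.
by apply: contraNneq => E; rewrite [P]monalgE E big_nil.
Qed.

(** The default value in [vv] is taken at the head of the support, itself a point of the support
    when [P] is nonzero. *)
Lemma vv_mem (r s : int) P : P != 0 ->
  exists2 u, u \in msupp P & vv l r s P = vpt l r s u.
Proof.
move=> /msupp_neq0; rewrite /vv; set x0 := head _ _ => nz.
have [u us ->] := bigmax_mem (vpt l r s) x0 (msupp P); exists u => //.
move: us; rewrite inE => /predU1P[->|//]; rewrite /x0.
exact: head_mem.
Qed.

Lemma vv_ge (r s : int) P u : u \in msupp P -> vpt l r s u <= vv l r s P.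
Proof. by move=> uP; apply: (@le_bigmax_seq _ _ _ _ _ u xpredT). Qed.

Lemma pol_deg_neq0 d P : pol d P != 0 -> P != 0.
Proof. by apply: contraNneq => ->; rewrite pol0. Qed.

Lemma vvE d P : fil d P -> pol d P != 0 -> vv l rho sigma P = d%:~R / l%:R.
Proof.
move=> fP pP; apply/eqP; rewrite eq_le; apply/andP; split.
  have [u uP ->] := vv_mem rho sigma (pol_deg_neq0 pP).
  by rewrite le_vpt_deg fP.
have [u uP du] := pol_eq0P pP.
by rewrite -du -vpt_deg; apply: vv_ge.
Qed.

Lemma vv_fil P : P != 0 ->
  exists d, [/\ vv l rho sigma P = d%:~R / l%:R, fil d P & pol d P != 0].
Proof.
move=> P0; have [u uP E] := vv_mem rho sigma P0; exists (deg u); split.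
- by rewrite E vpt_deg.
- by move=> w wP; rewrite -le_vpt_deg -vpt_deg -E; apply: vv_ge.
- exact: (pol_neq0 rho_gt0 uP).
Qed.

Lemma mcoeff_lt P u : (lt l rho sigma P)@_u =
  if vpt l rho sigma u == vv l rho sigma P then P@_u else 0.
Proof.
rewrite /lt raddf_sum /=.
under eq_bigr => w _ do rewrite mcoeffU.
have [uP|uP] := boolP (u \in msupp P); last first.
  rewrite big_seq_cond big1 => [|w /andP[wP _]].
    by rewrite mcoeff_outdom //; case: ifP.
  by case: eqP => // wu; rewrite -wu wP in uP.
rewrite big_mkcond (bigD1_seq u) ?fset_uniq // -[LHS]/(_ + _).
rewrite [X in _ + X]big1 ?addr0; first by case: ifP => // _; case: eqP.
by move=> w /eqP wu; case: ifP => // _; case: eqP.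
Qed.

Lemma mcoeff_lt_pol d P u : fil d P -> pol d P != 0 ->
  (lt l rho sigma P)@_u = if deg u == d then (pol d P)`_u.2 else 0.
Proof.
move=> fP pP; rewrite mcoeff_lt (vvE fP pP) eq_vpt_deg.
by case: eqP => // du; rewrite (coef_pol rho_gt0).
Qed.

Lemma lt_scale d c P Q : fil d P -> fil d Q -> pol d P = c *: pol d Q ->
  pol d P != 0 -> lt l rho sigma P = c *: lt l rho sigma Q.
Proof.
move=> fP fQ E pP; have pQ : pol d Q != 0.
  by apply: contraNneq pP => pQ; rewrite E pQ scaler0.
apply/malgP => u; rewrite mcoeffZ !(mcoeff_lt_pol _ _ (_ : pol d _ != 0)) //.
by rewrite E coefZ; case: ifP => //; rewrite mulr0.
Qed.

Lemma lt_neq0 P : P != 0 -> lt l rho sigma P != 0.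
Proof.
move=> P0; have [u uP E] := vv_mem rho sigma P0; apply/eqP => L0.
have := mcoeff_lt P u; rewrite L0 mcoeff0 -E eqxx => /esym/eqP.
by rewrite mcoeff_eq0 uP.
Qed.

Lemma wbr_rs_eq d c P Q R :
  vv l rho sigma P + vv l rho sigma Q - (rho + sigma)%:~R = d%:~R / l%:R ->
  fil d (wbr l P Q) -> fil d R ->
  pol d (wbr l P Q) = c *: pol d R -> c != 0 -> pol d R != 0 ->
  wbr_rs l rho sigma P Q = c *: lt l rho sigma R.
Proof.
move=> vE fB fR E c0 pR; have pB : pol d (wbr l P Q) != 0.
  by rewrite E scaler_eq0 negb_or c0 pR.
rewrite /wbr_rs vE (vvE fB pB) ltxx orbF (negPf (pol_deg_neq0 pB)).
exact: (lt_scale fB fR E pB).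
Qed.

(** A leading form of a nonzero element is nonzero, so [wbr_rs] vanishes only if the commutator is 0
    or has degree below [d]. *)
Lemma wbr_rs0 d P Q :
  vv l rho sigma P + vv l rho sigma Q - (rho + sigma)%:~R = d%:~R / l%:R ->
  fil d (wbr l P Q) -> wbr_rs l rho sigma P Q = 0 -> pol d (wbr l P Q) = 0.
Proof.
move=> vE fB; rewrite /wbr_rs vE; case: ifP => [/orP[/eqP ->|lt_d] _|].
- exact: pol0.
- by apply/eqP/negPn/negP => pB; rewrite (vvE fB pB) ltxx in lt_d.
move=> /negbT; rewrite negb_or => /andP[nz _] /eqP.
by rewrite (negPf (lt_neq0 nz)).
Qed.

(* Whether [x^(i/l) y^j] has degree [d] for some integer [i]. *)
Definition indeg d (j : nat) := (rho %| d - sigma * (l * j)%N%:Z)%Z.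
(** This characterizes the image of [pol d] ([supp_in_pol], [pol_hlift]). *)
Definition supp_in d (f : {poly K}) := forall j, f`_j != 0 -> indeg d j.

Lemma indegD d e i j : indeg d i -> indeg (d + e) (i + j) = indeg e j.
Proof.
rewrite /indeg => di.
have -> : d + e - sigma * (l * (i + j))%N%:Z =
  (d - sigma * (l * i)%N%:Z) + (e - sigma * (l * j)%N%:Z).
  by rewrite mulnDr PoszD; ring.
by rewrite rpredDl.
Qed.

Lemma supp_in_pol d P : supp_in d (pol d P).
Proof.
move=> j; apply: contraNT => nd; apply/eqP/coef_pol_notin => i.
apply: contraNneq nd => <-; rewrite /indeg /deg /= addrK.
exact: dvdz_mulr.
Qed.

Lemma coefM_neq0 (f g : {poly K}) n : (f * g)`_n != 0 ->
  exists i j, [/\ n = (i + j)%N, f`_i != 0 & g`_j != 0].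
Proof.
rewrite coefM => nz; have [/existsP[i /andP[fi gi]]|] :=
  boolP [exists i : 'I_n.+1, (f`_i != 0) && (g`_(n - i) != 0)].
  by exists i, (n - i)%N; rewrite subnKC // -ltnS.
rewrite negb_exists => /forallP H; case/eqP: nz; apply: big1 => i _.
by have := H i; rewrite negb_and !negbK => /orP[] /eqP ->; rewrite ?mul0r ?mulr0.
Qed.

Lemma supp_inM d e f g : supp_in d f -> supp_in e g -> supp_in (d + e) (f * g).
Proof.
by move=> df eg n /coefM_neq0[i [j [-> /df di /eg]]]; rewrite (indegD _ _ di).
Qed.

(** A quotient computed in K[y] must again lift to W^(l). With [f1] the part of [f] admissible in
    degree [d], the product (f - f1) g has only exponents admissible in degree d + e, whereas f - f1
    has none admissible in degree [d]; so it vanishes. *)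
Lemma supp_in_quo d e f g : g != 0 -> supp_in e g -> supp_in (d + e) (f * g) ->
  supp_in d f.
Proof.
move=> g0 eg dfg; pose f1 := \poly_(j < size f) (if indeg d j then f`_j else 0).
have f1E j : f1`_j = if indeg d j then f`_j else 0.
  by rewrite coef_poly; case: ltnP => // jf; rewrite nth_default //; case: ifP.
have df1 : supp_in d f1 by move=> j; rewrite f1E; case: ifP => //; rewrite eqxx.
suff -> : f = f1 by [].
apply/eqP; rewrite -subr_eq0; apply/eqP/(mulIf g0); rewrite mul0r.
apply/polyP => n; rewrite coef0; apply/eqP/negPn/negP => nz.
have n_in : indeg (d + e) n.
  apply: contraNT nz => nn; rewrite mulrBl coefB subr_eq0.
  have -> : (f * g)`_n = 0 by apply/eqP; apply: contraNT nn; apply: dfg.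
  by rewrite eq_sym; apply: contraNT nn; apply: supp_inM.
have [i [j [nE fi /eg ej]]] := coefM_neq0 nz.
move: fi; rewrite coefB f1E; rewrite nE addrC addnC (indegD _ _ ej) in n_in.
by rewrite n_in subrr eqxx.
Qed.

(** Inverse of [pol d] on admissible polynomials: the degree is solved for the exponent of x, by a
    division that is then exact. *)
Definition hlift d (f : {poly K}) : W K :=
  \sum_(j < size f) << f`_j *g (((d - sigma * (l * j)%N%:Z) %/ rho)%Z, j : nat) >>.

Lemma deg_hlift d (j : nat) : indeg d j ->
  deg (((d - sigma * (l * j)%N%:Z) %/ rho)%Z, j) = d.
Proof. by move=> dj; rewrite /deg /= mulrC divzK // subrK. Qed.

Lemma fil_hlift d f : supp_in d f -> fil d (hlift d f).
Proof.
move=> df; apply: fil_sum => j _; have [->|nz] := eqVneq f`_j 0.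
  by rewrite monalgU0; apply: fil0.
by apply: filU; rewrite deg_hlift ?df.
Qed.

Lemma pol_hlift d f : supp_in d f -> pol d (hlift d f) = f.
Proof.
move=> df; rewrite -[RHS]coefK poly_def /hlift linear_sum.
apply: eq_bigr => j _ /=; rewrite polU.
have [->|nz] := eqVneq f`_j 0; first by rewrite !scale0r; case: ifP.
by rewrite deg_hlift ?df ?eqxx.
Qed.

Lemma homogeneous_hlift d f : supp_in d f -> f != 0 ->
  homogeneous l rho sigma (hlift d f).
Proof.
move=> df f0; have fF := fil_hlift df.
apply/malgP => u; rewrite (mcoeff_lt_pol _ fF) ?pol_hlift //.
case: eqP => [du|du]; first by rewrite -[in RHS](coef_pol rho_gt0 _ du) pol_hlift.
rewrite /hlift raddf_sum big1 // => j _ /=; rewrite mcoeffU.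
have [->|nz] := eqVneq f`_j 0; first by rewrite mul0rn.
by case: eqP => // uE; case: du; rewrite -uE deg_hlift ?df.
Qed.

End Leading.

Local Opaque wbr.

(** * The monomials P^i Q^j, the homogeneous solution and the diagonal valuation *)

Section HomogeneousSolution.
Context (K : fieldType) (charK : [pchar K] =i pred0).
Context (l : nat) (l_gt0 : (0 < l)%N) (rho sigma : int).
Context (rho_gt0 : 0 < rho) (rs_gt0 : 0 < rho + sigma).
Implicit Types (P Q R : W K).
Local Notation fil := (@fil K l rho sigma).
Local Notation pol := (@pol K l rho sigma).
Local Notation h := (hdeg l rho sigma).

Definition wmonom P Q i j : W K :=
  iter i (wmul l P) (iter j (wmul l Q) (wone K)).

Lemma iter_wmulZ P i c R :
  iter i (wmul l P) (c *: R) = c *: iter i (wmul l P) R.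
Proof.
elim: i => [//|i IH]; rewrite !iterS [in LHS]IH.
exact: wmulZr.
Qed.

Lemma wbr_iter P i R :
  wbr l P (iter i (wmul l P) R) = iter i (wmul l P) (wbr l P R).
Proof. by elim: i => [//|i IH]; rewrite !iterS -IH; exact: wbrMl. Qed.

Lemma wbr_wmonom0 P Q i : wbr l P (wmonom P Q i 0) = 0.
Proof.
rewrite /wmonom wbr_iter /= wbr1 //.
by elim: i => [//|i IH]; rewrite iterS IH; exact: wmul0r.
Qed.

(** Inductive step for [P, Q^n], with [x] and [y] consecutive powers of Q. *)
Lemma wbr_wmul_eigen P Q (x y : W K) c :
  (forall R, wmul l (wbr l P Q) R = - R) -> wmul l Q y = x ->
  wbr l P x = c *: y -> wbr l P (wmul l Q x) = (c - 1) *: x.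
Proof.
move=> PQ xE E; transitivity (- x + c *: x); last first.
  by rewrite scalerBl scale1r addrC.
apply: etrans (wbrM charK l_gt0 P Q x) _; congr (_ + _); first exact: PQ.
apply: etrans (congr1 (wmul l Q) E) _.
by apply: etrans (wmulZr charK l_gt0 c Q y) _; rewrite xE.
Qed.

Lemma wbr_wmonomS P Q i j : wbr l Q P = wone K ->
  wbr l P (wmonom P Q i j.+1) = - j.+1%:R *: wmonom P Q i j.
Proof.
move=> QP; rewrite /wmonom wbr_iter -iter_wmulZ; congr (iter _ _ _).
have PQ R : wmul l (wbr l P Q) R = - R.
  rewrite wbrN QP -scaleN1r -[X in wmul l X]addr0 wmulPl // wmul1l // wmul0l //.
  by rewrite addr0 scaleN1r.
elim: j => [|j IH].
  rewrite [LHS]wbrM // PQ [iter 0 _ _]/= wbr1 // wmul0r // addr0.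
  by rewrite scaleN1r.
have -> : - j.+2%:R = - j.+1%:R - 1 :> K by rewrite -natr1 opprD.
exact: (wbr_wmul_eigen PQ (erefl (iter j.+1 (wmul l Q) (wone K))) IH).
Qed.

Lemma wmonom_fil P Q a b i j : fil a P -> fil b Q ->
  fil (a * i%:Z + b * j%:Z) (wmonom P Q i j).
Proof.
move=> fP fQ; elim: i => [|i IH].
  rewrite mulr0 add0r; elim: j => [|j IH].
    by apply: filU; rewrite /deg /= muln0 !mulr0.
  have -> : b * j.+1%:Z = b + b * j%:Z by lia.
  by have [] := wmul_fil_pol charK l_gt0 rho_gt0 rs_gt0 fQ IH.
have -> : a * i.+1%:Z + b * j%:Z = a + (a * i%:Z + b * j%:Z) by lia.
by have [] := wmul_fil_pol charK l_gt0 rho_gt0 rs_gt0 fP IH.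
Qed.

Lemma wmonom_pol P Q a i : fil a P ->
  fil (a * i%:Z) (wmonom P Q i 0) /\
  pol (a * i%:Z) (wmonom P Q i 0) = pol a P ^+ i.
Proof.
move=> fP; elim: i => [|i [fi pi]].
  rewrite mulr0; have d0 : deg l rho sigma (0, 0%N) = 0.
    by rewrite /deg /= muln0 !mulr0.
  by split; [apply: filU; rewrite d0 | rewrite polU d0 eqxx scale1r].
have -> : a * i.+1%:Z = a + a * i%:Z by lia.
have [fS pS] := wmul_fil_pol charK l_gt0 rho_gt0 rs_gt0 fP fi.
by split=> //; rewrite [LHS]pS pi exprS.
Qed.

Lemma exists_pbr_solution P Q a b : wbr l Q P = wone K ->
  0 < a -> 0 <= b -> fil a P -> fil b Q -> pol a P != 0 ->
  exists f, [/\ f != 0, supp_in l rho sigma h f &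
     pbr a h (pol a P) f = (rho * l%:Z)%:~R * pol a P].
Proof.
move=> QP a_gt0 b_ge0 fP fQ pP; have h_gt0 := hdeg_gt0 l_gt0 rho_gt0 rs_gt0.
have wP := fun e R fR => @wbr_fil_pol K charK l l_gt0 rho sigma rho_gt0 rs_gt0 a e P R fP fR.
pose D := wbr_lin charK l_gt0 P.
have [R [e [fR s0 E1]]] := @exists_second_bracket K charK l rho sigma rho_gt0
  a b h (rho * l%:Z) (pol a P) D (wmonom P Q) a_gt0 b_ge0 h_gt0 pP
  (fun e R fR => (wP e R fR).1) (fun e R fR => (wP e R fR).2)
  (wbr_wmonom0 P Q) (fun i j => @wbr_wmonomS P Q i j QP)
  (fun i j => @wmonom_fil P Q a b i j fP fQ) (fun i => (@wmonom_pol P Q a i fP).2).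
have := (wP _ _ fR).2; move: s0 E1; rewrite -[D R]/(wbr l P R).
have := @supp_in_pol K l rho sigma (a + e - h) (wbr l P R).
move: (pol (a + e - h) (wbr l P R)) => s s_in s0 E1 /esym E2.
have kap0 : (rho * l%:Z)%:~R != 0 :> {poly K}.
  by rewrite intr_poly_eq0 // mulf_neq0 ?lt0r_neq0 // ltz_nat.
have q0 : pol e R != 0.
  apply/eqP => q0; move: E2; rewrite q0 pbr0r => /esym/eqP.
  by rewrite mulf_eq0 (negPf kap0) (negPf s0).
have [f fE E] := pbr_solve charK a_gt0 h_gt0 pP q0 s0 E1 E2.
exists f; split=> //.
  apply/eqP => f0; move: fE; rewrite f0 mul0r => /esym/eqP.
  by rewrite mulf_eq0 (negPf pP) (negPf q0).
(* Degrees: h + (a + e - h) = a + e, the degree of the product equal to f s. *)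
apply: (supp_in_quo s0 s_in); rewrite fE addrC subrK.
by apply: supp_inM; apply: supp_in_pol.
Qed.

(** If the value were 0, a point [u] of the leading form with u.1 = l u.2 would give a = h u.2. A
    point (i, j) with j < u.2 has i <= l j, hence degree at most h j < a. So u.2 is the order of the
    leading form in y, and [pbr_order0] applies. *)
Lemma vv_diag_lt_neq0 P a f : 0 < a -> fil a P -> pol a P != 0 -> f != 0 ->
  pbr a h (pol a P) f = (rho * l%:Z)%:~R * pol a P ->
  vv l 1 (-1) (lt l rho sigma P) != 0.
Proof.
move=> a_gt0 fP pP f0 E; have h_gt0 := hdeg_gt0 l_gt0 rho_gt0 rs_gt0.
have P0 := pol_deg_neq0 pP.
have [u uL vE] := vv_mem l 1 (-1) (lt_neq0 l rho sigma P0).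
have ltC w := mcoeff_lt_pol l_gt0 rho_gt0 w fP pP.
have ltD w : w \in msupp (lt l rho sigma P) ->
    deg l rho sigma w = a /\ (pol a P)`_w.2 != 0.
  by rewrite -mcoeff_neq0 ltC; case: (deg _ _ _ w =P a); rewrite ?eqxx.
have [du pu] := ltD _ uL; apply/eqP => v0.
have d1 w : deg l 1 (-1) w = w.1 - (l * w.2)%N%:Z.
  by rewrite /deg mul1r mulN1r.
have uE : u.1 = (l * u.2)%N%:Z.
  (* Writes 0 as an integer over [l], the form required by [eq_vpt_deg]. *)
  move: v0; rewrite vE => /eqP; rewrite -(mul0r (l%:R)^-1) -(mulr0z 1).
  by rewrite (eq_vpt_deg l_gt0) d1 subr_eq0 => /eqP.
have aE : a = h * u.2%:Z.
  by rewrite -du /deg /hdeg uE PoszM; ring.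
have low j : (j < u.2)%N -> (pol a P)`_j = 0.
  move=> ju; apply/eqP/negPn/negP => pj.
  have dj : indeg l rho sigma a j by apply: supp_in_pol pj.
  set w := (((a - sigma * (l * j)%N%:Z) %/ rho)%Z, j).
  have dw : deg l rho sigma w = a := deg_hlift dj.
  have wL : w \in msupp (lt l rho sigma P).
    by rewrite -mcoeff_neq0 ltC dw eqxx.
  have := vv_ge l 1 (-1) wL; rewrite v0 -(mul0r (l%:R)^-1) -(mulr0z 1).
  rewrite (le_vpt_deg l_gt0) d1 /= subr_le0 => wle.
  have B : (rho + sigma) * (l * j)%N%:Z < (rho + sigma) * (l * u.2)%N%:Z.
    by rewrite ltr_pM2l // ltz_nat ltn_pmul2l.
  have A : rho * w.1 <= rho * (l * j)%N%:Z by rewrite ler_pM2l.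
  move: dw aE A B; rewrite /deg /hdeg /= !PoszM; move: (divz _ _) => i.
  by move=> dw aE A B; lia.
have pE : pol a P = 'X^(u.2) * drop_poly u.2 (pol a P).
  rewrite -{1}(poly_take_drop u.2 (pol a P)).
  rewrite [X in X + _](_ : _ = 0) ?add0r 1?mulrC //.
  by apply/polyP => j; rewrite coef_take_poly coef0; case: ltnP => // /low.
apply: (@pbr_order0 K charK a h (rho * l%:Z) u.2 (drop_poly u.2 (pol a P)) f) => //.
- by rewrite mulf_neq0 ?lt0r_neq0 // ltz_nat.
- apply/negP => /dvdpP[g gE]; case/negP: pu.
  by rewrite -[X in _`_X]add0n -coef_drop_poly gE coefMX.
- by rewrite -pE.
Qed.

Lemma vpt_st P : P != 0 ->
  vpt l 1 (-1) (st l rho sigma P) = vv l 1 (-1) (lt l rho sigma P).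
Proof.
move=> P0; have [u uL vE] := vv_mem l 1 (-1) (lt_neq0 l rho sigma P0).
rewrite /st; set S := filter _ _.
have : argmax_seq (fun u : expo => u.1%:~R) (0, 0%N) S \in S.
  apply: argmax_seq_mem; have : u \in S by rewrite mem_filter vE eqxx uL.
  by case: S.
by rewrite mem_filter => /andP[/eqP].
Qed.

End HomogeneousSolution.

(** * Deduction of the three conclusions from the solution [f] *)

Lemma intr_poly_cancel (K : fieldType) (charK : [pchar K] =i pred0)
    (a b k : int) (p q : {poly K}) : a != 0 -> k != 0 ->
  a%:~R * (k%:~R * p) = b%:~R * k%:~R * q -> p = (b%:~R / a%:~R) *: q.
Proof.
rewrite -(intr_poly_eq0 charK) -(intr_poly_eq0 charK k) => a0 k0 E.
apply: (mulfI k0); apply: (mulfI a0); rewrite E.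
have aba : a%:~R * (b%:~R / a%:~R)%:P = b%:~R :> {poly K}.
  rewrite !intr_poly -polyCM mulrCA divff ?mulr1 //.
  by rewrite -polyC_eq0 -intr_poly.
by rewrite -mul_polyC -{1}aba; ring.
Qed.

Theorem theorem3p5 (K : fieldType) (charK : [pchar K] =i pred0)
  (l : nat) (l_gt0 : (0 < l)%N) (P Q : W K) (rho sigma : int)
  (rs_coprime : coprimez rho sigma) (rs_pos : 0 < rho + sigma)
  (sigma_le0 : sigma <= 0)
  (QP_one : wbr l Q P = wone K)
  (vP_gt0 : 0 < vv l rho sigma P) (vQ_gt0 : 0 < vv l rho sigma Q)
  (PQ_rs : wbr_rs l rho sigma P Q = 0)
  (PQ_notN : ~ exists n : nat, vv l rho sigma P / vv l rho sigma Q = n%:R)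
  (QP_notN : ~ exists n : nat, vv l rho sigma Q / vv l rho sigma P = n%:R) :
  (~ inVal l rho sigma P -> vv l 1 (-1) (lt l rho sigma P) != 0)
  /\ vpt l 1 (-1) (st l rho sigma P) != 0
  /\ exists F : W K,
       [/\ homogeneous l rho sigma F,
           wbr_rs l rho sigma P F = lt l rho sigma P,
           wbr_rs l rho sigma Q F =
             ratr (vv l rho sigma Q / vv l rho sigma P) *: lt l rho sigma Q,
           vv l rho sigma F = (rho + sigma)%:~R
         & fpol l rho sigma (wbr l P F) = fpol l rho sigma P].
Proof.
have rho_gt0 : 0 < rho by lia.
have l0 : l%:R != 0 :> rat by rewrite pnatr_eq0 -lt0n.
have one0 : wone K != 0 by rewrite monalgU_eq0 oner_eq0.
have P0 : P != 0.
  by apply: contraNneq one0 => P0; rewrite -QP_one P0 wbr0r.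
have Q0 : Q != 0.
  by apply: contraNneq one0 => Q0; rewrite -QP_one Q0 wbr0l.
have [a [vP fP pP]] := vv_fil l_gt0 sigma rho_gt0 P0.
have [b [vQ fQ pQ]] := vv_fil l_gt0 sigma rho_gt0 Q0.
have a_gt0 : 0 < a.
  by move: vP_gt0; rewrite vP pmulr_lgt0 ?invr_gt0 ?ltr0n // ltr0z.
have b_gt0 : 0 < b.
  by move: vQ_gt0; rewrite vQ pmulr_lgt0 ?invr_gt0 ?ltr0n // ltr0z.
set h := hdeg l rho sigma.
have hE : (rho + sigma)%:~R = h%:~R / l%:R :> rat.
  by rewrite /h /hdeg intrM -pmulrn mulrAC divff ?mul1r.
have wB d e A B (fA : fil l rho sigma d A) (fB : fil l rho sigma e B) :=
  @wbr_fil_pol K charK l l_gt0 rho sigma rho_gt0 rs_pos d e A B fA fB.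
have [f [f0 f_in fE]] :=
  exists_pbr_solution charK l_gt0 rho_gt0 rs_pos QP_one a_gt0 (ltW b_gt0) fP fQ pP.
have kap0 : (rho * l%:Z)%:~R != 0 :> {poly K}.
  by rewrite intr_poly_eq0 // mulf_neq0 ?lt0r_neq0 // ltz_nat.
(* This gives (1), and (2) because [st] attains the maximum of v_{1,-1} on the leading form. *)
have diag := vv_diag_lt_neq0 charK l_gt0 rho_gt0 rs_pos a_gt0 fP pP f0 fE.
split=> [//|]; split; first by rewrite vpt_st.
(* Degree [h] corresponds to valuation rho + sigma, as required of F. *)
exists (hlift l rho sigma h f).
have fF := fil_hlift f_in; have pF := pol_hlift f_in.
have vF : vv l rho sigma (hlift l rho sigma h f) = (rho + sigma)%:~R.
  by rewrite hE; apply: vvE => //; rewrite pF.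
have pPF : pol l rho sigma a (wbr l P (hlift l rho sigma h f)) = pol l rho sigma a P.
  have := (wB _ _ _ _ fP fF).2; rewrite addrK pF fE; exact: mulfI.
have fPF : fil l rho sigma a (wbr l P (hlift l rho sigma h f)).
  by have := (wB _ _ _ _ fP fF).1; rewrite addrK.
have fQF : fil l rho sigma b (wbr l Q (hlift l rho sigma h f)).
  by have := (wB _ _ _ _ fQ fF).1; rewrite addrK.
(* [PQ_rs] makes the leading forms commute, so [pbr_transfer] can carry the equation from [P] over
   to [Q]. *)
have pPQ : pbr a b (pol l rho sigma a P) (pol l rho sigma b Q) = 0.
  have [fPQ <-] := wB _ _ _ _ fP fQ.
  rewrite (wbr_rs0 l_gt0 _ fPQ PQ_rs) ?mulr0 //.
  by rewrite vP vQ hE -/h !intrD intrN !mulrDl mulNr.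
have a0K : a%:~R != 0 :> K by rewrite intr_eq0_pchar0 // lt0r_neq0.
have b0K : b%:~R != 0 :> K by rewrite intr_eq0_pchar0 // lt0r_neq0.
have pQF : pol l rho sigma b (wbr l Q (hlift l rho sigma h f)) =
    (b%:~R / a%:~R) *: pol l rho sigma b Q.
  have := (wB _ _ _ _ fQ fF).2; rewrite addrK pF => E.
  have := pbr_transfer pP pPQ fE; rewrite -E => {}E.
  by apply: (intr_poly_cancel charK _ _ E); rewrite ?mulf_neq0 ?lt0r_neq0 // ltz_nat.
have vPF : vv l rho sigma P + vv l rho sigma (hlift l rho sigma h f) -
    (rho + sigma)%:~R = a%:~R / l%:R by rewrite vF addrK.
have vQF : vv l rho sigma Q + vv l rho sigma (hlift l rho sigma h f) -
    (rho + sigma)%:~R = b%:~R / l%:R by rewrite vF addrK.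
have pPF1 := etrans pPF (esym (scale1r (pol l rho sigma a P))).
split.
- exact: homogeneous_hlift.
- rewrite -[RHS]scale1r.
  exact: (wbr_rs_eq l_gt0 rho_gt0 vPF fPF fP pPF1 (oner_neq0 K) pP).
- have -> : vv l rho sigma Q / vv l rho sigma P = b%:~R / a%:~R.
    by rewrite vP vQ invf_div mulrA divfK.
  rewrite ratr_frac ?lt0r_neq0 //.
  have ba0 : b%:~R / a%:~R != 0 :> K by rewrite mulf_neq0 ?invr_eq0.
  exact: (wbr_rs_eq l_gt0 rho_gt0 vQF fQF fQ pQF ba0 pQ).
- exact: vF.
(* [fpol] depends only on the leading form, and those of [P, F] and [P] coincide. *)
- have pPF0 : pol l rho sigma a (wbr l P (hlift l rho sigma h f)) != 0.
    by rewrite [X in X != 0]pPF.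
  by rewrite /fpol (lt_scale l_gt0 rho_gt0 fPF fP pPF1 pPF0) scale1r.
Qed.
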